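(* Let $G$ be an algebraic group with a split $BN$-pair $(B,N)$, with $T=B\cap N$, $B=T\ltimes U$, $W=N/T$ and set $S$ of simple reflections, and let $k$ be any field. Let $M(tr)=kG\otimes_{kB}k_{tr}$ be the module induced from the trivial one-dimensional $kB$-module $k_{tr}$. Let $J$ be a subset of $S$, let $W_J$ be the subgroup of $W$ generated by $J$, and let $\eta_J=\sum_{w\in W_J}(-1)^{l(w)}w1_{tr}\in M(tr)$. Then: (a) The subspace $kUW\eta_J$, i.e. the $k$-span of all elements $u\,n_w\,\eta_J$ with $u\in U$, $w\in W$, is a $kG$-submodule of $M(tr)$. (b) In particular, $kU\eta_S=kU\sum_{w\in W}(-1)^{l(w)}w1_{tr}$ is a $kG$-submodule of $M(tr)$.
   Context: An algebraic group $G$ with a split $BN$-pair has closed subgroups $B$ and $N$ such that: (i) $B\cup N$ generates $G$, $T=B\cap N$ is normal in $N$, and all elements of $T$ are semisimple; (ii) $W=N/T$ is generated by a set $S$ of elements $s_i$ ($i\in I$) of order 2; (iii) if $n_i\in N$ maps to $s_i$ then $n_iBn_i\neq B$; (iv) for each $n\in N$ and each $n_i$, $n_iBn\subseteq Bn_inB\cup BnB$; (v) $B$ has a closed normal unipotent subgroup $U$ with $B=T\ltimes U$; (vi) $\bigcap_{n\in N}nBn^{-1}=T$. It is known that $W$ is a Weyl group (in particular a finite Coxeter group with simple reflections $S$); $l$ is its length function. For each $w\in W$ fix a representative $n_w\in N$. Fix a nonzero element $1_{tr}\in k_{tr}$ and write $x1_{tr}$ for $x\otimes 1_{tr}\in M(tr)$,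 $x\in kG$. For $w\in W$, $w1_{tr}:=n1_{tr}$ for any $n\in N$ with image $w$ (this is independent of the choice of $n$, since $T$ acts trivially on $1_{tr}$). The submodule in (b) is called the Steinberg module $\mathrm{St}$ of $G$. *)

(* Defs.v *)
From HB Require Import structures.
From mathcomp Require Import all_boot all_order all_algebra finmap.
From mathcomp Require Import boolp classical_sets functions cardinality fsbigop.
From mathcomp.multinomials Require Import monalg.
From mathcomp.multinomials Require mpoly.

Set Implicit Arguments.
Unset Strict Implicit.
Unset Printing Implicit Defensive.

Import GRing.Theory.
Local Open Scope classical_set_scope.
Local Open Scope quotient_scope.
Local Open Scope ring_scope.

(* The group algebra kG: finitely supported functions G -> k under
   convolution.  monalg only puts a ring structure on {malg k[M]} for monoids
   M without nontrivial units, hence the new type. *)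
Section GroupAlgebra.
Variables (k : fieldType) (G : groupType).

Definition group_algebra : Type := {malg k[G]}.

HB.instance Definition _ := GRing.Zmodule.on group_algebra.

Implicit Types (a b c : group_algebra).

Definition ga_one : group_algebra := << 1 *g 1%g >>.

Definition ga_mul a b : group_algebra :=
  \sum_(x <- msupp a) \sum_(y <- msupp b) << a@_x * b@_y *g (x * y)%g >>.

Lemma ga_mulw (d1 d2 : {fset G}) a b :
  fsubset (msupp a) d1 -> fsubset (msupp b) d2 ->
  ga_mul a b = \sum_(x <- d1) \sum_(y <- d2) << a@_x * b@_y *g (x * y)%g >>.
Proof.
move=> le_d1 le_d2; rewrite /ga_mul (big_fset_incl _ le_d1) /=.
  apply: eq_bigr => x _; apply/big_fset_incl => // y _ /mcoeff_outdom ->.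
  by rewrite mulr0 monalgU0.
move=> x _ /mcoeff_outdom ax.
by rewrite big1 => // y _; rewrite ax mul0r monalgU0.
Qed.

Lemma ga_mulDl : left_distributive ga_mul +%R.
Proof.
move=> a b c.
rewrite (ga_mulw (msuppD_le a b) (fsubset_refl _)).
rewrite (ga_mulw (fsubsetUl (msupp a) (msupp b)) (fsubset_refl (msupp c))).
rewrite (ga_mulw (fsubsetUr (msupp a) (msupp b)) (fsubset_refl (msupp c))).
rewrite -big_split; apply: eq_bigr => x _ /=.
rewrite -big_split; apply: eq_bigr => y _ /=.
by rewrite mcoeffD mulrDl monalgUD.
Qed.

Lemma ga_mulDr : right_distributive ga_mul +%R.
Proof.
move=> c a b.
rewrite (ga_mulw (fsubset_refl _) (msuppD_le a b)).
rewrite (ga_mulw (fsubset_refl (msupp c)) (fsubsetUl (msupp a) (msupp b))).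
rewrite (ga_mulw (fsubset_refl (msupp c)) (fsubsetUr (msupp a) (msupp b))).
rewrite -big_split; apply: eq_bigr => x _ /=.
rewrite -big_split; apply: eq_bigr => y _ /=.
by rewrite mcoeffD mulrDr monalgUD.
Qed.

Lemma ga_mul0l : left_zero 0 ga_mul.
Proof. by move=> a; rewrite /ga_mul msupp0 big_seq_fset0. Qed.

Lemma ga_mul0r : right_zero 0 ga_mul.
Proof. by move=> a; rewrite /ga_mul big1 // => x _; rewrite msupp0 big_seq_fset0. Qed.

Lemma ga_mulUU (r s : k) (x y : G) :
  ga_mul << r *g x >> << s *g y >> = << r * s *g (x * y)%g >>.
Proof. by rewrite (ga_mulw msuppU_le msuppU_le) !big_seq_fset1 !mcoeffUU. Qed.

Lemma ga_mul_suml I (s : seq I) (F : I -> group_algebra) b :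
  ga_mul (\sum_(i <- s) F i) b = \sum_(i <- s) ga_mul (F i) b.
Proof.
exact: (big_morph (ga_mul^~ b) (fun x y => ga_mulDl x y b) (ga_mul0l b)).
Qed.

Lemma ga_mul_sumr I (s : seq I) (F : I -> group_algebra) b :
  ga_mul b (\sum_(i <- s) F i) = \sum_(i <- s) ga_mul b (F i).
Proof.
exact: (big_morph (ga_mul b) (fun x y => ga_mulDr b x y) (ga_mul0r b)).
Qed.

Lemma ga_mulA : associative ga_mul.
Proof.
move=> a b c; rewrite [a]monalgE [b]monalgE [c]monalgE.
move: (msupp a) (msupp b) (msupp c) => sa sb sc.
rewrite (ga_mul_suml sa) (ga_mul_suml sa _ (\sum_(y <- sb) _)) ga_mul_suml.
apply: eq_bigr => x _.
rewrite (ga_mul_suml sb) (ga_mul_sumr sb) (ga_mul_sumr sb) ga_mul_suml.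
apply: eq_bigr => y _.
rewrite (ga_mul_sumr sc) (ga_mul_sumr sc) (ga_mul_sumr sc).
apply: eq_bigr => z _.
by rewrite !ga_mulUU mulrA mulgA.
Qed.

Lemma ga_mul1l : left_id ga_one ga_mul.
Proof.
move=> a; rewrite [a]monalgE (ga_mul_sumr (msupp a)); apply: eq_bigr => x _.
by rewrite ga_mulUU mul1r mul1g.
Qed.

Lemma ga_mul1r : right_id ga_one ga_mul.
Proof.
move=> a; rewrite [a]monalgE (ga_mul_suml (msupp a)); apply: eq_bigr => x _.
by rewrite ga_mulUU mulr1 mulg1.
Qed.

Lemma ga_one_neq0 : ga_one != 0.
Proof. by rewrite monalgU_eq0 oner_eq0. Qed.

HB.instance Definition _ := GRing.Zmodule_isNzRing.Build group_algebra
  ga_mulA ga_mul1l ga_mul1r ga_mulDl ga_mulDr ga_one_neq0.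

Definition ga_of (x : G) : group_algebra := << 1 *g x >>.
Definition ga_scalar (c : k) : group_algebra := << c *g 1%g >>.

(* For a subgroup H of G, this is the subalgebra kH of kG. *)
Definition ga_sub (H : set G) : set group_algebra :=
  [set a | [set` msupp a] `<=` H].

(* The action of kG (hence of every kH) on the trivial module k_tr, which is
   k as an abelian group. *)
Definition triv_act (a : group_algebra) (c : k) : k :=
  (\sum_(x <- msupp a) a@_x) * c.

End GroupAlgebra.

(* A (x)_D Y, for D a subring of A and Y an abelian group on which D acts
   through act: the free abelian group on A * Y modulo the usual relations.
   Left multiplication makes it a left A-module. *)
Section Tensor.
Variables (A : nzRingType) (D : set A) (Y : zmodType) (act : A -> Y -> Y).

Local Notation F := {malg (A * Y)%type}.

Inductive tensor_rel : set F :=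
| TensorDl a1 a2 y :
    tensor_rel (<< (a1 + a2, y) >> - << (a1, y) >> - << (a2, y) >>)
| TensorDr a y1 y2 :
    tensor_rel (<< (a, y1 + y2) >> - << (a, y1) >> - << (a, y2) >>)
| TensorBal a d y of D d :
    tensor_rel (<< (a * d, y) >> - << (a, act d y) >>).

Definition tensor_ker : {pred F} :=
  [in smallest (fun H : set F => zmod_closed [in H]) tensor_rel].

Lemma tensor_ker_closed : zmod_closed tensor_ker.
Proof.
split; first by rewrite inE => H [[+ _] _]; rewrite inE.
move=> x y; rewrite !inE => xK yK H HP; have [[_ HB] _] := HP.
by have := HB x y; rewrite !inE; apply; [exact: xK|exact: yK].
Qed.

HB.instance Definition _ :=
  GRing.isZmodClosed.Build F tensor_ker tensor_ker_closed.

Lemma tensor_rel_ker z : tensor_rel z -> z \in tensor_ker.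
Proof. by move=> zR; rewrite inE; apply: sub_gen_smallest. Qed.

Definition tensor : Type := Quotient.quot tensor_ker.

HB.instance Definition _ := GRing.Zmodule.on tensor.

Definition tensor_pi (z : F) : tensor := \pi_(Quotient.quot tensor_ker) z.

Definition tens (a : A) (y : Y) : tensor := tensor_pi << (a, y) >>.

Lemma tensor_piB : {morph tensor_pi : x y / x - y}.
Proof. by move=> x y; rewrite /tensor_pi !piE. Qed.

HB.instance Definition _ := GRing.isZmodMorphism.Build F tensor tensor_pi tensor_piB.

Lemma tensor_pi_eq x y : (tensor_pi x == tensor_pi y) = (x - y \in tensor_ker).
Proof. by rewrite Quotient.idealrBE. Qed.

Definition lmul (a : A) (z : F) : F :=
  \sum_(p <- msupp z) << z@_p *g (a * p.1, p.2) >>.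

Lemma lmulw (d : {fset (A * Y)%type}) a z : fsubset (msupp z) d ->
  lmul a z = \sum_(p <- d) << z@_p *g (a * p.1, p.2) >>.
Proof.
move=> zd; apply: big_fset_incl => // p _ /mcoeff_outdom ->.
by rewrite monalgU0.
Qed.

Lemma lmulB a : {morph lmul a : x y / x - y}.
Proof.
move=> x y; rewrite (lmulw _ (msuppB_le x y)).
rewrite (lmulw _ (fsubsetUl _ (msupp y))) (lmulw _ (fsubsetUr (msupp x) _)).
rewrite -sumrB; apply: eq_bigr => p _.
by rewrite mcoeffB monalgUB.
Qed.

HB.instance Definition _ a := GRing.isZmodMorphism.Build F F (lmul a) (lmulB a).

Lemma lmulU a (n : int) b y :
  lmul a << n *g (b, y) >> = << n *g (a * b, y) >>.
Proof. by rewrite (lmulw _ msuppU_le) big_seq_fset1 mcoeffUU. Qed.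

Lemma lmulA a b z : lmul a (lmul b z) = lmul (a * b) z.
Proof.
rewrite [in LHS]/lmul -/(lmul b z) -/(lmul a _) (raddf_sum (lmul a)) /=.
by apply: eq_bigr => -[c y] _ /=; rewrite lmulU mulrA.
Qed.

Lemma lmul1 z : lmul 1 z = z.
Proof.
by rewrite [RHS]monalgE; apply: eq_bigr => -[c y] _ /=; rewrite mul1r.
Qed.

Lemma malgU_int (n : int) (p : A * Y) : << n *g p >> = << p >> *~ n :> F.
Proof. by rewrite -[n in LHS]intz raddfMz. Qed.

Lemma lmulDl_ker a b z : lmul (a + b) z - (lmul a z + lmul b z) \in tensor_ker.
Proof.
rewrite /lmul -big_split -sumrB; apply: rpred_sum => -[c y] _ /=.
move: (z@_(c, y)) => n; rewrite opprD addrA.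
have -> : << n *g ((a + b) * c, y) >> - << n *g (a * c, y) >>
    - << n *g (b * c, y) >> = (<< ((a + b) * c, y) >> - << (a * c, y) >>
    - << (b * c, y) >>) *~ n :> F.
  by rewrite !(malgU_int n) !mulrzBl.
have h : << ((a + b) * c, y) >> - << (a * c, y) >> - << (b * c, y) >>
    \in tensor_ker by rewrite mulrDl; apply/tensor_rel_ker/TensorDl.
by case: n => m; rewrite ?NegzE ?mulrNz ?rpredN rpredMn.
Qed.

Lemma lmul_ker a z : z \in tensor_ker -> lmul a z \in tensor_ker.
Proof.
rewrite inE => zK; pose H : set F := [set z | lmul a z \in tensor_ker].
suff /(_ z zK) : smallest (fun H : set F => zmod_closed [in H]) tensor_rel
  `<=` H by [].
apply: smallest_sub.
  split=> [|x y /set_mem xK /set_mem yK]; apply: mem_set; rewrite /H /=.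
    by rewrite (raddf0 (lmul a)) rpred0.
  by rewrite lmulB rpredB.
move=> _ [a1 a2 y|b y1 y2|b d y Dd]; rewrite /H /= !lmulB !lmulU.
- by rewrite mulrDr; apply/tensor_rel_ker/TensorDl.
- exact/tensor_rel_ker/TensorDr.
- by rewrite mulrA; apply/tensor_rel_ker/TensorBal.
Qed.

Definition tensor_scale (a : A) (m : tensor) : tensor :=
  tensor_pi (lmul a (repr (m : Quotient.quot tensor_ker))).

Lemma tensor_scale_pi a z : tensor_scale a (tensor_pi z) = tensor_pi (lmul a z).
Proof.
apply/eqP; rewrite tensor_pi_eq -raddfB lmul_ker //.
by rewrite -tensor_pi_eq /tensor_pi reprK.
Qed.

Lemma tensorW (P : tensor -> Prop) : (forall z, P (tensor_pi z)) -> forall m, P m.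
Proof.
by move=> H m; have := H (repr (m : Quotient.quot tensor_ker)); rewrite /tensor_pi reprK.
Qed.

Lemma tensor_scaleA a b m :
  tensor_scale a (tensor_scale b m) = tensor_scale (a * b) m.
Proof. by elim/tensorW: m => z; rewrite !tensor_scale_pi lmulA. Qed.

Lemma tensor_scale1 : left_id 1 tensor_scale.
Proof. by elim/tensorW => z; rewrite tensor_scale_pi lmul1. Qed.

Lemma tensor_scaleDr : right_distributive tensor_scale +%R.
Proof.
move=> a m1 m2; elim/tensorW: m1 => z1; elim/tensorW: m2 => z2.
by rewrite -raddfD !tensor_scale_pi -raddfD -raddfD.
Qed.

Lemma tensor_scaleDl m : {morph tensor_scale^~ m : a b / a + b}.
Proof.
move=> a b; elim/tensorW: m => z; rewrite !tensor_scale_pi -raddfD.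
by apply/eqP; rewrite tensor_pi_eq lmulDl_ker.
Qed.

HB.instance Definition _ := GRing.Zmodule_isLmodule.Build A tensor
  tensor_scaleA tensor_scale1 tensor_scaleDr tensor_scaleDl.

End Tensor.

(* A linear algebraic group over K: a Zariski closed subgroup of GL_n(K). *)
Section LinearAlgebraicGroup.
Variable K : closedFieldType.

Definition zeros n (P : set (mpoly.mpoly (n * n) K)) : set 'M[K]_n :=
  [set A | forall p, P p -> mpoly.meval (fun i => mxvec A 0 i) p = 0].

Record linear_algebraic_group := LinearAlgebraicGroup {
  lag_sort :> groupType;
  lag_dim : nat;
  lag_mx : lag_sort -> 'M[K]_lag_dim;
  lag_mx1 : lag_mx 1%g = 1%:M;
  lag_mxM : forall x y, lag_mx (x * y)%g = lag_mx x *m lag_mx y;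
  lag_mx_inj : injective lag_mx;
  lag_mx_closed : exists P, range lag_mx = [set` unitmx] `&` zeros P
}.

Variable G : linear_algebraic_group.

Definition zariski_closed (X : set G) :=
  exists P, X = @lag_mx G @^-1` zeros P.

Definition semisimple (g : G) : Prop := diagonalizable (lag_mx g).

Definition unipotent (g : G) := exists m, (lag_mx g - 1%:M) ^+ m = 0.

End LinearAlgebraicGroup.

Section SplitBNPair.
Local Open Scope group_scope.

Section Group.
Variable G : groupType.
Implicit Types (A B H N T : set G) (S J : set (set G)).

Definition subgroup H := group_closed [in H].

Definition gen : set G -> set G := smallest subgroup.

Definition setmul A B : set G := [set x * y | x in A & y in B].
Definition setinv A : set G := [set x^-1 | x in A].
Definition setconj (n : G) A : set G := [set n * x * n^-1 | x in A].

Definition normal_in H N :=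
  H `<=` N /\ forall n, N n -> setconj n H = H.

(* The elements of N / T are the cosets nT, themselves subsets of G, and they
   are multiplied as subsets; T is the identity. *)
Definition coset_group N T : set (set G) := [set setmul [set n] T | n in N].

Definition coset_subgroup T (H : set (set G)) :=
  H T /\ forall v w, H v -> H w -> H (setmul v (setinv w)).

Definition coset_gen T : set (set G) -> set (set G) :=
  smallest (coset_subgroup T).

(* As S consists of involutions, no inverses are needed in words. *)
Definition word T S m (w : set G) :=
  exists s : seq (set G),
    [/\ size s = m, [set` s] `<=` S & w = foldr setmul T s].

Definition coxeter_length T S (w : set G) : nat :=
  xget 0%N [set m | word T S m w /\
                    forall m', word T S m' w -> (m <= m')%N].

End Group.

Variables (K : closedFieldType) (G : linear_algebraic_group K).

(* T is B `&` N.  Elements of S are cosets, so that s n says that n is an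
   element of N with image s in N / T. *)
Record split_BN_pair (B N U : set G) (S : set (set G)) : Prop := SplitBNPair {
  bn_B_subgroup : subgroup B;
  bn_B_closed : zariski_closed B;
  bn_N_subgroup : subgroup N;
  bn_N_closed : zariski_closed N;
  bn_gen : gen (B `|` N) = [set: G];
  bn_T_normal : normal_in (B `&` N) N;
  bn_T_semisimple : (B `&` N) `<=` @semisimple K G;
  bn_S_sub : S `<=` coset_group N (B `&` N);
  bn_S_order2 : forall s, S s -> s <> B `&` N /\ setmul s s = B `&` N;
  bn_S_gen : coset_gen (B `&` N) S = coset_group N (B `&` N);
  bn_neq : forall s n, S s -> s n ->
    setmul (setmul [set n] B) [set n] <> B;
  bn_mul : forall s ni n, S s -> s ni -> N n ->
    setmul (setmul [set ni] B) [set n] `<=`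
      setmul (setmul B [set ni * n]) B `|` setmul (setmul B [set n]) B;
  bn_U_subgroup : subgroup U;
  bn_U_closed : zariski_closed U;
  bn_U_normal : normal_in U B;
  bn_U_unipotent : U `<=` @unipotent K G;
  bn_TU : setmul (B `&` N) U = B;
  bn_TU1 : (B `&` N) `&` U = [set 1];
  bn_saturated : \bigcap_(n in N) setconj n B = B `&` N
}.

End SplitBNPair.

Section InducedModule.
Variables (k : fieldType) (G : groupType) (B : set G).

(* kG (x)_{kB} k_tr *)
Definition induced_triv : Type := tensor (ga_sub B) (@triv_act k G).

HB.instance Definition _ := GRing.Lmodule.on induced_triv.

Definition k_subspace (V : set induced_triv) :=
  V 0 /\ forall (c : k) x y, V x -> V y -> V (ga_scalar G c *: x + y).

Definition kspan : set induced_triv -> set induced_triv := smallest k_subspace.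

Variables (N : set G) (S : set (set G)) (rep : set G -> G) (one_tr : k).

(* sum_{w in X} (-1)^{l(w)} w 1_tr, where rep w is an element of the coset w.
   The sum is 0 by convention if X is infinite; N / T is finite here. *)
Definition alt_sum (X : set (set G)) : induced_triv :=
  \sum_(w \in X) (-1) ^+ coxeter_length (B `&` N) S w *:
    (tens _ _ (ga_of k (rep w)) one_tr : induced_triv).

Definition eta_sum (J : set (set G)) := alt_sum (coset_gen (B `&` N) J).

End InducedModule.

(* Main.v *)
(* Everything happens in the permutation module k[G/B], with chambers gB.  Write
   eta for eta_J and let s in J, with representative n.

   Stability of kB eta under n.  Let w0 be the longest element of W_J and
   e = s w0.  As w0 = s e is longer than e, the stabiliser of eB in B moves the
   chambers nbB transitively; an element of B fixing eB also fixes vB for every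
   v in W_J with sv > v, because v lies on a geodesic from 1 to e.  So one may
   assume that b fixes all these vB.  If y = n b n^-1 is not in B, then
   y = b1 n c where b1, and then also c, can be chosen with the same property,
   and comparing the terms v and sv gives y eta = eta - b1 eta, while
   n eta = - eta.  Hence n b eta = b1 eta - eta.

   For g in BwB write w = w' x with x in W_J and w' of minimal length in wW_J;
   then g eta lies in kBw' kB eta, and for b in B some b' in B satisfies
   w' b eta = b' w' eta: the two sides agree on the chambers B and w0 B, hence on
   all xB with x in W_J, which lie on geodesics between them.  This is (a); (b) is the
   stability of kB eta = kU eta for J = S.

   If W_J is infinite, eta_J is 0 by the convention on infinite sums. *)
Require Import Defs.
From HB Require Import structures.
From mathcomp Require Import all_boot all_order all_algebra finmap.
From mathcomp Require Import boolp classical_sets functions cardinality fsbigop.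
From mathcomp.multinomials Require Import monalg.

Set Implicit Arguments.
Unset Strict Implicit.
Unset Printing Implicit Defensive.

Import GRing.Theory.
Local Open Scope classical_set_scope.

(** * Products of subsets of a group *)

Section SetProducts.
Local Open Scope group_scope.
Variable G : groupType.
Implicit Types (A B C H : set G) (g : G).

Local Notation "A ** B" := (setmul A B) (at level 40, left associativity).

Lemma setmulP A B g : (A ** B) g <-> exists a b, [/\ A a, B b & g = a * b].
Proof.
split=> [[a Aa [b Bb <-]]|[a [b [Aa Bb ->]]]]; first by exists a, b.
by exists a => //; exists b.
Qed.

Lemma setmulM A B a b : A a -> B b -> (A ** B) (a * b).
Proof. by move=> Aa Bb; exists a => //; exists b. Qed.

Lemma setmulA A B C : A ** (B ** C) = A ** B ** C.
Proof.
apply/seteqP; split=> g.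
  by case=> a Aa [_ [b Bb [c Cc <-]] <-]; rewrite mulgA; do !apply: setmulM.
by case=> _ [a Aa [b Bb <-]] [c Cc <-]; rewrite -mulgA; do !apply: setmulM.
Qed.

Lemma setmulS A A' B B' : A `<=` A' -> B `<=` B' -> A ** B `<=` A' ** B'.
Proof. by move=> sA sB g [a Aa [b Bb <-]]; apply: setmulM; auto. Qed.

Lemma setmulSl A B B' : B `<=` B' -> A ** B `<=` A ** B'.
Proof. exact: setmulS. Qed.

Lemma setmulSr A A' B : A `<=` A' -> A ** B `<=` A' ** B.
Proof. by move=> sA; apply: setmulS. Qed.

Lemma setmulUl A A' B : (A `|` A') ** B = A ** B `|` A' ** B.
Proof.
apply/seteqP; split=> [g [a [] Aa [b Bb <-]]|g [[a Aa [b Bb <-]]|[a Aa [b Bb <-]]]].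
- by left; apply: setmulM.
- by right; apply: setmulM.
- by apply: setmulM => //; left.
- by apply: setmulM => //; right.
Qed.

Lemma setinvP A g : setinv A g <-> A g^-1.
Proof. by split=> [[a Aa <-]|Ag]; [rewrite invgK|exists g^-1; rewrite ?invgK]. Qed.

Lemma setinvK A : setinv (setinv A) = A.
Proof. by apply/seteqP; split=> g; rewrite !setinvP invgK. Qed.

Lemma setinvM A B : setinv (A ** B) = setinv B ** setinv A.
Proof.
apply/seteqP; split=> [_ [_ [a Aa [b Bb <-]] <-]|_ [_ [b Bb <-] [_ [a Aa <-] <-]]].
  by rewrite invgM; apply: setmulM; apply/setinvP; rewrite invgK.
by rewrite -invgM; apply/setinvP; rewrite invgK; apply: setmulM.
Qed.

Lemma setinvS A B : A `<=` B -> setinv A `<=` setinv B.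
Proof. by move=> AB g /setinvP/AB Bg; apply/setinvP. Qed.

Lemma subgroup1 H : subgroup H -> H 1.
Proof. by case; rewrite inE. Qed.

Lemma subgroupM H x y : subgroup H -> H x -> H y -> H (x * y).
Proof.
move=> /group_closedM HM Hx Hy.
by have := HM x y; rewrite !inE; apply.
Qed.

Lemma subgroupV H x : subgroup H -> H x -> H x^-1.
Proof. by move=> /group_closedV HV Hx; have := HV x; rewrite !inE; apply. Qed.

Lemma subgroup_setinv H : subgroup H -> setinv H = H.
Proof.
move=> sH; apply/seteqP; split=> g; rewrite setinvP => /(subgroupV sH) //.
by rewrite invgK.
Qed.

Lemma subgroup_setmul H A : subgroup H -> A `<=` H -> A 1 -> A ** H = H.
Proof.
move=> sH AH A1; apply/seteqP; split=> [_ [a /AH Ha [h Hh <-]]|h Hh].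
  exact: subgroupM.
by rewrite -[h]mul1g; apply: setmulM.
Qed.

Lemma setmul_subgroup H A : subgroup H -> A `<=` H -> A 1 -> H ** A = H.
Proof.
move=> sH AH A1; rewrite -[LHS]setinvK setinvM (subgroup_setinv sH).
rewrite subgroup_setmul ?(subgroup_setinv sH) //.
  by move=> g /setinvP/AH/(subgroupV sH); rewrite invgK.
by apply/setinvP; rewrite invg1.
Qed.

Lemma gen_subP H A : subgroup H -> A `<=` H -> gen A `<=` H.
Proof. by move=> sH AH; apply: smallest_sub. Qed.

End SetProducts.

(** * BN-pairs *)

Section BNPair.
Local Open Scope group_scope.
Variable G : groupType.

(* split_BN_pair without the Zariski topology, U and the saturation axiom (vi). *)
Record BN_pair (B N : set G) (S : set (set G)) : Prop := BNPair {
  BN_B : subgroup B;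
  BN_N : subgroup N;
  BN_T_normal : normal_in (B `&` N) N;
  BN_S_sub : S `<=` coset_group N (B `&` N);
  BN_S_order2 : forall s, S s -> s <> B `&` N /\ setmul s s = B `&` N;
  BN_S_gen : coset_gen (B `&` N) S = coset_group N (B `&` N);
  BN_gen : gen (B `|` N) = [set: G];
  BN_neq : forall s n, S s -> s n ->
    setmul (setmul [set n] B) [set n] <> B;
  BN_mul : forall s ni n, S s -> s ni -> N n ->
    setmul (setmul [set ni] B) [set n] `<=`
      setmul (setmul B [set ni * n]) B `|` setmul (setmul B [set n]) B
}.

Variables (B N : set G) (S : set (set G)) (BN : BN_pair B N S).
Implicit Types (J : set (set G)) (s t v w x y z : set G) (l : seq (set G)).

Local Notation "A ** C" := (setmul A C) (at level 40, left associativity).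
Local Notation T := (B `&` N).
Local Notation W := (coset_group N T).

Let B1 : B 1 := subgroup1 (BN_B BN).
Let BM g h : B g -> B h -> B (g * h) := subgroupM (BN_B BN).
Let BV g : B g -> B g^-1 := subgroupV (BN_B BN).
Let N1 : N 1 := subgroup1 (BN_N BN).
Let NM g h : N g -> N h -> N (g * h) := subgroupM (BN_N BN).
Let NV g : N g -> N g^-1 := subgroupV (BN_N BN).

(** * The quotient N/T, with cosets multiplied as subsets *)

Lemma T_subgroup : subgroup T.
Proof.
split; first by apply: mem_set.
move=> g h; rewrite !inE => -[Bg Ng] [Bh Nh].
by split; [apply/BM/BV|apply/NM/NV].
Qed.

Let TM g h : T g -> T h -> T (g * h) := subgroupM T_subgroup.
Let TV g : T g -> T g^-1 := subgroupV T_subgroup.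

Lemma T_conj n g : N n -> T g -> T (n * g * n^-1).
Proof.
by move=> Nn Tg; have [_ /(_ n Nn) <-] := BN_T_normal BN; exists g.
Qed.

Lemma cosetP w n : W w -> w n ->
  N n /\ (forall m, w m <-> T (n^-1 * m)).
Proof.
move=> [m Nm <-] /setmulP[_ [t [-> Tt ->]]]; split; first by apply: NM => //; case: Tt.
move=> p; rewrite invgM -mulgA; split.
  by move=> /setmulP[_ [u [-> Tu ->]]]; rewrite mulKg; apply/TM/Tu/TV.
move=> Tp; rewrite -[p](mulVKg m); apply: setmulM => //.
by rewrite -[m^-1 * p](mulVKg t); apply/TM.
Qed.

Lemma coset_ex w : W w -> exists n, w n.
Proof.
by case=> n Nn <-; exists n; rewrite -[X in _ X]mulg1; apply: setmulM.
Qed.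

Lemma coset_eq v w n : W v -> W w -> v n -> w n -> v = w.
Proof.
move=> Wv Ww vn wn; apply/seteqP.
have [_ Hv] := cosetP Wv vn; have [_ Hw] := cosetP Ww wn.
by split=> m; rewrite Hv Hw.
Qed.

Lemma coset_N w n : W w -> w n -> N n.
Proof. by move=> Ww /(cosetP Ww)[]. Qed.

Lemma coset_of_N n : N n -> exists2 w, W w & w n.
Proof.
move=> Nn; exists ([set n] ** T); first by exists n.
by rewrite -[X in _ X]mulg1; apply: setmulM.
Qed.

Lemma coset_T : W T.
Proof.
exists 1 => //; apply/seteqP; split=> [_ [_ -> [t Tt <-]]|t Tt]; first by rewrite mul1g.
by rewrite -[t]mul1g; apply: setmulM.
Qed.

Lemma coset_mulP v w n m : W v -> W w -> v n -> w m ->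
  v ** w = [set n * m] ** T.
Proof.
move=> Wv Ww vn wm; apply/seteqP; split=> [_ [a va [b wb <-]]|_ [_ -> [t Tt <-]]].
  have [_ /(_ a)/iffLR/(_ va) Ta] := cosetP Wv vn.
  have [Nb /(_ m)/iffLR/(_ wm) Tb] := cosetP Ww wb.
  rewrite -[a * b](mulVKg (n * m)); apply: setmulM => //.
  have -> : (n * m)^-1 * (a * b) = (b^-1 * m)^-1 * (b^-1 * (n^-1 * a) * b^-1^-1).
    by rewrite !invgM !invgK !mulgA mulgK.
  by apply: TM; [exact: TV|apply: T_conj => //; exact: NV].
rewrite -mulgA; apply: setmulM => //.
have [_ /(_ (m * t)) H] := cosetP Ww wm.
by apply/H; rewrite mulKg.
Qed.

Lemma coset_mul v w : W v -> W w -> W (v ** w).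
Proof.
move=> Wv Ww; have [n vn] := coset_ex Wv; have [m wm] := coset_ex Ww.
rewrite (coset_mulP Wv Ww vn wm); exists (n * m) => //.
by apply: NM; [apply: coset_N vn|apply: coset_N wm].
Qed.

Lemma coset_mulT w : W w -> w ** T = w.
Proof.
by move=> [n Nn <-]; rewrite -setmulA (subgroup_setmul T_subgroup).
Qed.

Lemma coset_Tmul w : W w -> T ** w = w.
Proof.
move=> Ww; have [n wn] := coset_ex Ww.
by apply: (@coset_eq _ _ n) => //; [apply: coset_mul => //; exact: coset_T
  |rewrite -[X in _ X]mul1g; apply: setmulM].
Qed.

Lemma coset_inv w : W w -> W (setinv w).
Proof.
move=> Ww; have [n wn] := coset_ex Ww; have Nn := coset_N Ww wn.
exists n^-1; first exact: NV.
apply/seteqP; split=> [_ [_ -> [t Tt <-]]|g /setinvP wg].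
  apply/setinvP; rewrite invgM invgK.
  have [_ ->] := cosetP Ww wn; rewrite mulgA.
  by have := T_conj (NV Nn) (TV Tt); rewrite invgK.
rewrite -[g](mulKg n); apply: setmulM => //.
have [_ /(_ n)/iffLR/(_ wn)] := cosetP Ww wg; rewrite invgK => /(T_conj Nn).
by rewrite mulgA mulgK.
Qed.

Lemma coset_invr w : W w -> w ** setinv w = T.
Proof.
move=> Ww; have [n wn] := coset_ex Ww.
have vn : setinv w n^-1 by apply/setinvP; rewrite invgK.
apply: (@coset_eq _ _ 1) => //; last by rewrite -(mulgV n); apply: setmulM.
  exact/coset_mul/coset_inv.
exact: coset_T.
Qed.

Lemma coset_invl w : W w -> setinv w ** w = T.
Proof.
by move=> Ww; rewrite -{2}(setinvK w); apply: coset_invr; apply: coset_inv.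
Qed.

Lemma coset_mulKV v w : W v -> W w -> v ** (setinv v ** w) = w.
Proof. by move=> Wv Ww; rewrite setmulA coset_invr ?coset_Tmul. Qed.

Lemma coset_mulK v w : W v -> W w -> setinv v ** (v ** w) = w.
Proof. by move=> Wv Ww; rewrite setmulA coset_invl ?coset_Tmul. Qed.

Lemma coset_mulIr v w x : W v -> W w -> W x -> v ** x = w ** x -> v = w.
Proof.
move=> Wv Ww Wx /(congr1 (fun y => y ** setinv x)).
by rewrite -!setmulA coset_invr // !coset_mulT.
Qed.

Lemma S_coset s : S s -> W s.
Proof. exact: BN_S_sub. Qed.

Lemma S_sq s : S s -> s ** s = T.
Proof. by move=> /(BN_S_order2 BN)[]. Qed.

Lemma S_mulK s w : S s -> W w -> s ** (s ** w) = w.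
Proof. by move=> Ss Ww; rewrite setmulA S_sq ?coset_Tmul. Qed.

Lemma S_inv s : S s -> setinv s = s.
Proof.
move=> Ss; have Ws := S_coset Ss; have Wi := coset_inv Ws.
by apply: (@coset_mulIr _ _ s) => //; rewrite coset_invl // S_sq.
Qed.

Lemma S_mul_neq s w : S s -> W w -> s ** w <> w.
Proof.
move=> Ss Ww e; have [+ _] := BN_S_order2 BN Ss; apply.
apply: (@coset_mulIr _ _ w) => //; [exact: S_coset|exact: coset_T|].
by rewrite coset_Tmul.
Qed.

(** * Words in the simple reflections and the subgroups W_J *)

Definition words J : set (set G) :=
  [set w | exists2 l, [set` l] `<=` J & w = foldr (@setmul G) T l].

Lemma sub_cons J s l : [set` s :: l] `<=` J <-> J s /\ [set` l] `<=` J.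
Proof.
split=> [H|[Js Jl] t /=].
  by split=> [|t tl]; apply: H; rewrite /= inE ?eqxx // tl orbT.
by rewrite inE => /orP[/eqP->|/Jl].
Qed.

Lemma sub_cat J l l' :
  [set` l ++ l'] `<=` J <-> [set` l] `<=` J /\ [set` l'] `<=` J.
Proof.
split=> [H|[Jl Jl'] t /=].
  by split=> t tl; apply: H; rewrite /= mem_cat tl ?orbT.
by rewrite mem_cat => /orP[/Jl|/Jl'].
Qed.

Lemma foldr_coset l : [set` l] `<=` S -> W (foldr (@setmul G) T l).
Proof.
elim: l => [|s l IH] /=; first by move=> _; exact: coset_T.
by move=> /sub_cons[/S_coset Ws /IH]; exact: coset_mul.
Qed.

Lemma foldr_cat l l' : [set` l] `<=` S -> [set` l'] `<=` S ->
  foldr (@setmul G) T (l ++ l') = foldr (@setmul G) T l ** foldr (@setmul G) T l'.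
Proof.
move=> Sl Sl'; elim: l Sl => [|s l IH] /=; first by rewrite coset_Tmul //; exact: foldr_coset.
by move=> /sub_cons[Ss Sl]; rewrite IH // setmulA.
Qed.

Lemma words_coset J w : J `<=` S -> words J w -> W w.
Proof. by move=> JS [l lJ ->]; apply: foldr_coset; apply: subset_trans JS. Qed.

Lemma words_T J : words J T.
Proof. by exists [::]. Qed.

Lemma words_mul J v w : J `<=` S -> words J v -> words J w -> words J (v ** w).
Proof.
move=> JS [l Jl ->] [l' Jl' ->]; exists (l ++ l'); first exact/sub_cat.
by rewrite foldr_cat //; apply: subset_trans JS.
Qed.

Lemma words_gen J s : J `<=` S -> J s -> words J s.
Proof.
move=> JS Js; exists [:: s]; first by apply/sub_cons; split.
by rewrite /= coset_mulT //; apply/S_coset/JS.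
Qed.

Lemma words_inv J w : J `<=` S -> words J w -> words J (setinv w).
Proof.
move=> JS [l + ->]; elim: l => [|s l IH] /=.
  by move=> _; rewrite (subgroup_setinv T_subgroup); exact: words_T.
move=> /sub_cons[Js Jl]; rewrite setinvM (S_inv (JS _ Js)).
by apply: words_mul; [|exact: IH|exact: words_gen].
Qed.

Lemma coset_genE J : J `<=` S -> coset_gen T J = words J.
Proof.
move=> JS; apply/seteqP; split.
  apply: smallest_sub; last by move=> s; exact: words_gen.
  split; first exact: words_T.
  by move=> v w Jv Jw; apply: words_mul => //; apply: words_inv.
move=> _ [l + ->] H [[HT HM] JH]; elim: l => [//|s l IH] /= /sub_cons[Js Jl].
have Wl : W (foldr (@setmul G) T l) by apply: foldr_coset; apply: subset_trans JS.
(* [coset_subgroup] provides only quotients, so sw is formed as s (w^-1)^-1, with w^-1 obtained as T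
   w^-1. *)
rewrite -[foldr _ _ _]setinvK; apply: (HM); first exact: JH.
by rewrite -(coset_Tmul (coset_inv Wl)); apply: HM => //; apply: IH.
Qed.

(** * Double cosets BwB *)

Definition cell w : set G := B ** w ** B.

Lemma cell_coset w g : w g -> cell w g.
Proof.
by move=> wg; rewrite -[g]mul1g -[1 * g]mulg1; do !apply: setmulM.
Qed.

Lemma setmulBB : B ** B = B.
Proof. exact: subgroup_setmul (BN_B BN) _ B1. Qed.

Lemma mulB_cell w : B ** cell w = cell w.
Proof. by rewrite /cell !setmulA setmulBB. Qed.

Lemma cell_mulB w : cell w ** B = cell w.
Proof. by rewrite /cell -!setmulA setmulBB. Qed.

Lemma cell_Bl w b g : B b -> cell w g -> cell w (b * g).
Proof. by move=> Bb wg; rewrite -mulB_cell; apply: setmulM. Qed.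

Lemma cell_Br w b g : B b -> cell w g -> cell w (g * b).
Proof. by move=> Bb wg; rewrite -cell_mulB; apply: setmulM. Qed.

Lemma cell_T : cell T = B.
Proof.
rewrite /cell (setmul_subgroup (BN_B BN)) ?setmulBB //.
Qed.

Lemma cell_inv w : setinv (cell w) = cell (setinv w).
Proof. by rewrite /cell !setinvM (subgroup_setinv (BN_B BN)) setmulA. Qed.

Lemma cell_invP w g : cell w g -> cell (setinv w) g^-1.
Proof. by move=> wg; rewrite -cell_inv setinvP invgK. Qed.

Lemma cellP w n g : W w -> w n -> cell w g ->
  exists b c, [/\ B b, B c & g = b * n * c].
Proof.
move=> Ww wn [_ [b Bb [m wm <-]] [c Bc <-]].
exists b, (n^-1 * m * c); split=> //; last by rewrite !mulgA mulgK.
have [_ /(_ m)/iffLR/(_ wm) [? _]] := cosetP Ww wn; exact: BM.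
Qed.

Lemma S_cell s w : S s -> W w -> s ** cell w `<=` cell (s ** w) `|` cell w.
Proof.
move=> Ss Ww _ [m sm [_ [_ [b Bb [n wn <-]] [c Bc <-]] <-]].
have Nn := coset_N Ww wn.
have : setmul (setmul [set m] B) [set n] (m * b * n) by do !apply: setmulM.
rewrite !mulgA => /(BN_mul BN Ss sm Nn)[] [_ [b' Bb' [_ -> <-]] [c' Bc' <-]];
  [left|right]; rewrite -mulgA; apply: setmulM; try exact: BM; apply: setmulM => //.
exact: setmulM.
Qed.

Lemma cell_S s w : S s -> W w -> cell w ** s `<=` cell (w ** s) `|` cell w.
Proof.
move=> Ss Ww; rewrite -[X in X `<=` _]setinvK -[X in _ `<=` X]setinvK.
apply: setinvS => g; rewrite setinvM cell_inv S_inv //.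
move=> /(S_cell Ss (coset_inv Ww))[] h; apply/setinvP; [left|right];
  move: h => /cell_invP; rewrite ?setinvM setinvK ?S_inv //.
Qed.

(** * Length function and disjointness of the double cosets *)

Local Notation len := (coxeter_length T S).

Lemma coset_words w : W w <-> words S w.
Proof. by rewrite -coset_genE // BN_S_gen. Qed.

Lemma lenP w : W w ->
  exists2 l, [set` l] `<=` S /\ size l = len w & w = foldr (@setmul G) T l.
Proof.
move=> /coset_words[l lS wE].
pose P m := `[< word T S m w >].
have Pex : exists m, P m by exists (size l); apply/asboolP; exists l.
have := @xgetPex _ 0%N [set m | word T S m w /\
                    forall m', word T S m' w -> (m <= m')%N].
case.
  case: (ex_minnP Pex) => m /asboolP mw min_m; exists m; split=> // m' m'w.
  exact/min_m/asboolP.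
by rewrite -/(coxeter_length T S w) => -[l' [<- l'S wE']] _; exists l'.
Qed.

Lemma len_le l : [set` l] `<=` S -> (len (foldr (@setmul G) T l) <= size l)%N.
Proof.
move=> lS; set w := foldr _ _ _.
have := @xgetPex _ 0%N [set m | word T S m w /\
                    forall m', word T S m' w -> (m <= m')%N].
rewrite -/(coxeter_length T S w); case; last by move=> _; apply; exists l.
have Pex : exists m, `[< word T S m w >] by exists (size l); apply/asboolP; exists l.
case: (ex_minnP Pex) => m /asboolP mw min_m; exists m; split=> // m' m'w.
exact/min_m/asboolP.
Qed.

Lemma len_S_le s w : S s -> W w -> (len (s ** w) <= (len w).+1)%N.
Proof.
move=> Ss /lenP[l [lS <-] ->].
by apply: (@len_le (s :: l)); apply/sub_cons.
Qed.

Lemma len_S_ge s w : S s -> W w -> (len w <= (len (s ** w)).+1)%N.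
Proof.
move=> Ss Ww; rewrite -{1}(S_mulK Ss Ww); apply: len_S_le => //.
by apply: coset_mul => //; exact: S_coset.
Qed.

(** Induction on the word. Removing its first letter s leaves an element lying in the double coset
    of the tail and in BsvB or BvB. In the first case the tail spells sv; in the second it would
    spell v, which is too long for that. *)
Lemma bruhat_le l v g : [set` l] `<=` S -> W v -> (size l <= len v)%N ->
  cell (foldr (@setmul G) T l) g -> cell v g -> foldr (@setmul G) T l = v.
Proof.
elim: l v g => [|s l IH] v g /=.
  move=> _ Wv _; rewrite cell_T => Bg; have [n vn] := coset_ex Wv.
  move=> /(cellP Wv vn)[b [c [Bb Bc gE]]].
  apply: (@coset_eq _ _ n) => //; first exact: coset_T.
  split; last exact: coset_N vn.
  have -> : n = b^-1 * g * c^-1 by rewrite gE !mulgA mulgK mulVg mul1g.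
  by apply: BM; [apply: BM => //|]; exact: BV.
move=> /sub_cons[Ss lS] Wv lev gsw gv.
have Ws := S_coset Ss; have Ww := foldr_coset lS.
have [n sn] := coset_ex Ws; have [m wm] := coset_ex Ww.
have [b [c [Bb Bc gE]]] := cellP (coset_mul Ws Ww) (setmulM sn wm) gsw.
have si : s n^-1 by rewrite -(S_inv Ss); apply/setinvP; rewrite invgK.
have wmc : cell (foldr (@setmul G) T l) (m * c).
  by apply: cell_Br => //; exact: cell_coset.
have : (s ** cell v) (m * c).
  have -> : m * c = n^-1 * (b^-1 * g) by rewrite gE !mulgA mulgVK mulVg mul1g.
  by apply: setmulM => //; apply: cell_Bl => //; exact: BV.
have lev' : (size l <= len (s ** v))%N.
  by rewrite -ltnS; apply: leq_trans lev _; exact: len_S_ge.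
move=> /(S_cell Ss Wv)[] h.
  by rewrite (IH _ _ lS (coset_mul Ws Wv) lev' wmc h) S_mulK.
have e := IH _ _ lS Wv (ltnW lev) wmc h.
by move: lev; rewrite -e ltnNge len_le.
Qed.

Lemma bruhat v w g : W v -> W w -> cell v g -> cell w g -> v = w.
Proof.
move=> Wv Ww; have [l [lS lv] vE] := lenP Wv; have [l' [l'S lw] wE] := lenP Ww.
have [le|/ltnW le] := leqP (len v) (len w).
  by rewrite {1 2}vE => gv gw; apply: bruhat_le gv gw; rewrite ?lv.
by rewrite {1 2}wE => gv gw; apply/esym; apply: bruhat_le gw gv; rewrite ?lw.
Qed.

(** * The exchange condition *)

(** This is the relation l(sw) > l(w), expressed by double cosets so that it can be used before
    lengths are compared; [up_len] and [not_up_len] give the translation. *)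
Definition up s w := s ** cell w `<=` cell (s ** w).

Lemma not_up s w : S s -> W w -> ~ up s w ->
  exists2 g, (s ** cell w) g & cell w g.
Proof.
move=> Ss Ww nup; apply: contrapT => h; apply: nup => g sg.
have [//|gw] := S_cell Ss Ww sg.
by exfalso; apply: h; exists g.
Qed.

Lemma up_T s : S s -> up s T.
Proof.
move=> Ss; have Ws := S_coset Ss; rewrite /up cell_T coset_mulT //.
by move=> _ [m sm [b Bb <-]]; apply: cell_Br => //; exact: cell_coset.
Qed.

(** Some element of sBvtB lies in BvtB, while sBvtB is contained in the union of BsvtB and BsvB. As
    svt differs from vt, disjointness of double cosets leaves sv = vt. *)
Lemma up_not_up_mulr s v t : S s -> S t -> W v -> up s v -> ~ up s (v ** t) ->
  s ** v = v ** t.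
Proof.
move=> Ss St Wv us nus; have Ws := S_coset Ss; have Wt := S_coset St.
have Wvt := coset_mul Wv Wt.
have [g + gvt] := not_up Ss Wvt nus.
have sub : s ** cell (v ** t) `<=` cell (s ** v ** t) `|` cell (s ** v).
  have vt : cell (v ** t) `<=` cell v ** t ** B.
    rewrite /cell -!setmulA; do 2!apply: setmulSl.
    by move=> h th; rewrite -[h]mul1g; apply: setmulM.
  apply: (subset_trans (setmulSl (A := s) vt)).
  rewrite (setmulA s (cell v ** t) B) (setmulA s (cell v) t).
  have us' : s ** cell v ** t ** B `<=` cell (s ** v) ** t ** B.
    by do 2!apply: setmulSr.
  apply: (subset_trans us').
  rewrite -[X in _ `<=` _ `|` X]cell_mulB -[cell (_ ** t)]cell_mulB -setmulUl.
  by apply: setmulSr; apply: cell_S => //; exact: coset_mul.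
move=> /sub[] h.
  exfalso; have e := bruhat (coset_mul (coset_mul Ws Wv) Wt) Wvt h gvt.
  by apply: (S_mul_neq Ss Wvt); rewrite setmulA.
by apply: bruhat h gvt => //; exact: coset_mul.
Qed.

Lemma foldr_rcons l t : [set` l] `<=` S -> S t ->
  foldr (@setmul G) T (rcons l t) = foldr (@setmul G) T l ** t.
Proof.
move=> lS St; rewrite -cats1 foldr_cat //; last by apply/sub_cons.
by rewrite /= coset_mulT //; exact: S_coset.
Qed.

(** Induction on a word of w, adding letters on the right: by [up_not_up_mulr], a letter t can
    destroy [up s x] only if sx = xt, and then sxt = x. *)
Lemma up_or s w : S s -> W w -> up s w \/ up s (s ** w).
Proof.
move=> Ss /coset_words[l + ->]; elim/last_ind: l => [|l t IH].
  by left; exact: up_T.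
rewrite -cats1 => /sub_cat[lS /sub_cons[St _]]; rewrite cats1 foldr_rcons //.
have Wv := foldr_coset lS; have Wt := S_coset St; have Ws := S_coset Ss.
set v := foldr _ _ _ in Wv *.
have step x : W x -> up s x -> up s (x ** t) \/ up s (s ** (x ** t)).
  move=> Wx ux; case: (pselect (up s (x ** t))) => h; [by left|right].
  by rewrite -(up_not_up_mulr Ss St Wx ux h) S_mulK.
case: (IH lS) => /step; first exact.
rewrite -setmulA => /(_ (coset_mul Ws Wv)); rewrite S_mulK; [by case; [right|left]|by []|].
exact: coset_mul.
Qed.

(** [BN_neq] enters here: if sBsB were contained in B, then nBn = B would follow. *)
Lemma not_up_self s : S s -> ~ up s s.
Proof.
move=> Ss; rewrite /up S_sq // cell_T => h; have Ws := S_coset Ss.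
have [n sn] := coset_ex Ws.
have hB m c p : s m -> B c -> s p -> B (m * c * p).
  move=> sm Bc sp; apply: h; rewrite -mulgA; apply: setmulM => //.
  by apply: cell_Bl => //; exact: cell_coset.
have si : s n^-1 by rewrite -(S_inv Ss); apply/setinvP; rewrite invgK.
apply: (BN_neq BN Ss sn); apply/seteqP; split=> [_ [_ [_ -> [b Bb <-]] [_ -> <-]]|b Bb].
  exact: hB.
have -> : b = n * (n^-1 * b * n^-1) * n by rewrite !mulgA mulgV mul1g mulgVK.
by do !apply: setmulM => //; exact: hB.
Qed.

Lemma up_not_up s w : S s -> W w -> up s w -> ~ up s (s ** w).
Proof.
move=> Ss Ww u1 u2; have Ws := S_coset Ss; rewrite /up S_mulK // in u2.
(* As [up s s] fails, sBsB meets BsB. A common element, multiplied on the right by c^-1 n, lands in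
   both BswB and BwB. *)
have [g [m sm [h hs <-]] gs] := not_up Ss Ws (not_up_self Ss).
have [n wn] := coset_ex Ww; have wnc := cell_coset wn.
have [k sk] := coset_ex Ws.
have [b [c [Bb Bc hE]]] := cellP Ws sk hs; have [b' [c' [Bb' Bc' gE]]] := cellP Ws sk gs.
apply: (S_mul_neq Ss Ww).
apply: (@bruhat _ _ (m * h * (c^-1 * n))) => //; first exact: coset_mul.
  rewrite gE -!mulgA; apply: cell_Bl => //; apply: u1; apply: setmulM => //.
  by apply: cell_Bl => //; apply: cell_Bl => //; exact: BV.
rewrite hE -!mulgA; apply: u2; apply: setmulM => //; apply: cell_Bl => //.
by apply: u1; rewrite mulVKg; apply: setmulM.
Qed.

(** Peel letters off the right end until the remaining prefix v satisfies [up s v]. The last letter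
    t peeled off then satisfies sv = vt, and it is the one deleted. *)
Lemma exchange s l : S s -> [set` l] `<=` S -> ~ up s (foldr (@setmul G) T l) ->
  exists l1 t l2, l = l1 ++ t :: l2 /\
    s ** foldr (@setmul G) T l = foldr (@setmul G) T (l1 ++ l2).
Proof.
move=> Ss; elim/last_ind: l => [|l t IH]; first by move=> _ /(_ (up_T Ss)).
rewrite -cats1 => /sub_cat[lS /sub_cons[St _]]; rewrite cats1 foldr_rcons // => nu.
have Wv := foldr_coset lS; case: (pselect (up s (foldr (@setmul G) T l))) => [u|].
  exists l, t, [::]; rewrite !cats0 cats1; split=> //.
  by rewrite -(up_not_up_mulr Ss St Wv u nu) S_mulK.
move=> /(IH lS)[l1 [r [l2 [lE sl]]]]; exists l1, r, (rcons l2 t).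
rewrite lE -rcons_cons -rcons_cat; split=> //.
rewrite setmulA -lE sl -rcons_cat foldr_rcons //.
by move: lS; rewrite lE => /sub_cat[? /sub_cons[_ ?]]; apply/sub_cat.
Qed.

Lemma not_up_len s w : S s -> W w -> ~ up s w -> len w = (len (s ** w)).+1.
Proof.
move=> Ss Ww nu; apply/eqP; rewrite eqn_leq len_S_ge //=.
have [l [lS <-] wE] := lenP Ww; move: nu; rewrite {}wE => /(exchange Ss lS).
move=> [l1 [t [l2 [lE ->]]]]; rewrite lE size_cat /= addnS ltnS -size_cat.
apply: len_le; apply/sub_cat.
by move: lS; rewrite lE => /sub_cat[? /sub_cons[_ ?]].
Qed.

Lemma up_len s w : S s -> W w -> up s w -> len (s ** w) = (len w).+1.
Proof.
move=> Ss Ww /(up_not_up Ss Ww) /not_up_len-> //; first by rewrite S_mulK.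
by apply: coset_mul => //; exact: S_coset.
Qed.

(** * Products of double cosets whose lengths add *)

Lemma len_T : len T = 0%N.
Proof. by apply/eqP; rewrite -leqn0; apply: (@len_le [::]). Qed.

Lemma len_mul_le v w : W v -> W w -> (len (v ** w) <= len v + len w)%N.
Proof.
move=> /lenP[l [lS <-] ->] /lenP[l' [l'S <-] ->].
by rewrite -foldr_cat // -size_cat; apply/len_le/sub_cat.
Qed.

Lemma cell_mul_sub v w : cell (v ** w) `<=` B ** v ** cell w.
Proof.
move=> _ [_ [b Bb [_ [n vn [m wm <-]] <-]] [c Bc <-]].
have -> : b * (n * m) * c = (b * n) * (m * c) by rewrite !mulgA.
by apply: setmulM; [exact: setmulM|apply: cell_Br => //; exact: cell_coset].
Qed.

Lemma mulB_up s w : up s w -> B ** s ** cell w `<=` cell (s ** w).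
Proof.
by move=> u; rewrite -setmulA -[X in _ `<=` X]mulB_cell; apply: setmulSl.
Qed.

(** Additivity of lengths forces each letter of a reduced word of v to lengthen the product, so
    [mulB_up] applies letter by letter. *)
Lemma cell_mul v w : W v -> W w -> (len v + len w <= len (v ** w))%N ->
  cell v ** cell w `<=` cell (v ** w).
Proof.
case/lenP=> [l [lS <-] {v}->] Ww; elim: l lS => [|s l IH] /=.
  by move=> _ _; rewrite cell_T mulB_cell coset_Tmul.
move=> /sub_cons[Ss lS]; have Wv := foldr_coset lS; rewrite addSn -setmulA => le.
set v := foldr _ _ _ in IH Wv le *; have Wvw := coset_mul Wv Ww.
have u : up s (v ** w).
  apply: contrapT => /(not_up_len Ss Wvw) e; have := len_mul_le Wv Ww.
  have lv : (len v <= size l)%N by exact: len_le.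
  by rewrite e ltnNge (leq_trans _ (ltnW le)) // leq_add2r.
apply: subset_trans (mulB_up u).
apply: subset_trans (setmulSl (IH lS _)); last first.
  by rewrite -ltnS -(up_len Ss Wvw u).
by rewrite setmulA; apply: setmulSr; exact: cell_mul_sub.
Qed.

(** * Chambers fixed by elements of G *)

(** In G/B this says that g fixes the chamber wB; by [fixes_rep] it may be tested on one
    representative. *)
Definition fixes g w := forall n, w n -> B (n^-1 * g * n).

Lemma fixes_rep g w n : W w -> w n -> B (n^-1 * g * n) -> fixes g w.
Proof.
move=> Ww wn Bg m wm.
have -> : m^-1 * g * m = (m^-1 * n) * (n^-1 * g * n) * (n^-1 * m).
  by rewrite !mulgA !mulgK.
have [_ /(_ m)/iffLR/(_ wm)[? _]] := cosetP Ww wn.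
have [_ /(_ n)/iffLR/(_ wn)[? _]] := cosetP Ww wm.
by apply: BM => //; apply: BM.
Qed.

Lemma fixesV g w : fixes g w -> fixes g^-1 w.
Proof. by move=> gw n /gw /BV; rewrite !invgM invgK mulgA. Qed.

Lemma S_invg s n : S s -> s n -> s n^-1.
Proof. by move=> Ss sn; rewrite -(S_inv Ss) setinvP invgK. Qed.

(** With [parabolic_Bmul] this gives what is used of the rank one parabolic subgroup: the elements
    to be placed in it are products of elements of B and representatives of s. *)
Lemma parabolic_mul s n g : S s -> s n -> (B `|` cell s) g -> (B `|` cell s) (n * g).
Proof.
move=> Ss sn [Bg|sg].
  by right; apply: cell_Br => //; exact: cell_coset.
have := S_cell Ss (S_coset Ss) (setmulM sn sg).
by rewrite S_sq // cell_T.
Qed.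

Lemma parabolic_Bmul s b g : B b -> (B `|` cell s) g -> (B `|` cell s) (b * g).
Proof. by move=> Bb [Bg|sg]; [left; exact: BM|right; exact: cell_Bl]. Qed.

Lemma len_S s : S s -> len s = 1%N.
Proof.
by move=> Ss; rewrite -(coset_mulT (S_coset Ss)) up_len ?len_T //;
  [exact: coset_T|exact: up_T].
Qed.

(** In the panel of type s through wB, the chamber wB is the only one in BwB, the projection of B:
    the others lie in BwsB because lengths add. *)
Lemma cell_parabolic w s n g : W w -> S s -> (len w < len (w ** s))%N ->
  w n -> (B `|` cell s) g -> cell w (n * g) -> B g.
Proof.
move=> Ww Ss lt wn [//|sg] wng; exfalso.
have Ws := S_coset Ss.
have : cell (w ** s) (n * g).
  apply: cell_mul => //; first by rewrite (len_S Ss) addn1.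
  by apply: setmulM => //; exact: cell_coset.
move=> /(bruhat Ww (coset_mul Ww Ws) wng) e.
by move: lt; rewrite -e ltnn.
Qed.

(** b stabilises B and the panel containing wB and wsB, hence the projection of B on this panel,
    which is wB. *)
Lemma fixes_mulr w s b : W w -> S s -> (len w < len (w ** s))%N -> B b ->
  fixes b (w ** s) -> fixes b w.
Proof.
move=> Ww Ss lt Bb fb n wn; have [m sm] := coset_ex (S_coset Ss).
apply: (cell_parabolic Ww Ss lt wn); last first.
  by rewrite -mulgA mulVKg; apply: cell_Bl => //; exact: cell_coset.
have := fb _ (setmulM wn sm); rewrite invgM => Bf.
have -> : n^-1 * b * n = m * ((m^-1 * n^-1 * b * (n * m)) * m^-1).
  by rewrite !mulgA mulgK mulgV mul1g.
apply: parabolic_mul => //; apply: parabolic_Bmul; first by rewrite -!mulgA in Bf *.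
by right; apply: cell_coset; exact: S_invg.
Qed.

(** vB lies on a geodesic from B to vwB, along which [fixes_mulr] walks back one panel at a time. *)
Lemma fixes_gate v w b : W v -> W w -> (len v + len w <= len (v ** w))%N ->
  B b -> fixes b (v ** w) -> fixes b v.
Proof.
move=> Wv /lenP[l [lS <-] ->] + Bb; elim: l v Wv lS => [|s l IH] v Wv /=.
  by move=> _ _; rewrite coset_mulT.
move=> /sub_cons[Ss lS]; have Ws := S_coset Ss; have Wl := foldr_coset lS.
have Wvs := coset_mul Wv Ws.
rewrite setmulA addnS -addSn => le fb.
have ltv : (len v < len (v ** s))%N.
  have := leq_trans le (len_mul_le Wvs Wl).
  by move=> /leq_trans/(_ (leq_add (leqnn _) (len_le lS))); rewrite leq_add2r.
apply: (fixes_mulr Wv Ss ltv Bb).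
apply: (IH _ Wvs) => //; apply: leq_trans le; rewrite leq_add2r.
by apply: leq_trans (len_mul_le Wv Ws) _; rewrite (len_S Ss) addn1.
Qed.

(* The elements of B fixing a chamber that is farther from sB than from B move the chambers
   other than B of the panel of s transitively. *)
Lemma fixes_transitive s e n b : S s -> W e -> up s e -> s n -> B b ->
  exists b' c, [/\ b = b' * c, B b', fixes b' e, B c & B (n^-1 * c * n)].
Proof.
move=> Ss We u sn Bb; have [k ek] := coset_ex We.
have sni := S_invg Ss sn; have Ws := S_coset Ss.
(* Seen from nB, both eB and its image under b^-1 are at distance se, so some c^-1 in the stabiliser
   of nB carries the first to the second. Then b' = b c^-1 fixes eB. *)
have : cell (s ** e) (n^-1 * (b^-1 * k)).
  by apply: u; apply: setmulM => //; apply: cell_Bl; [exact: BV|exact: cell_coset].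
move=> /(cellP (coset_mul Ws We) (setmulM sni ek))[b2 [b3 [Bb2 Bb3 E]]].
pose c := n * b2^-1 * n^-1; pose b' := b * c^-1.
have b'E : b' = k * b3^-1 * k^-1.
  have -> : b' = (n^-1 * (b^-1 * k) * k^-1)^-1 * b2 * n^-1.
    by rewrite /b' /c !invgM !invgK !mulgA mulgV mul1g.
  by rewrite E !invgM !invgK !mulgA mulgVK mulgK.
have bE : b = b' * c by rewrite mulgVK.
have fb' : fixes b' e.
  by apply: (fixes_rep We ek); rewrite b'E !mulgA mulVg mul1g mulgVK; exact: BV.
(* b' lies in B or BsB and fixes eB, whereas an element of BsB would carry eB into BseB. *)
have Bb' : B b'.
  have : (B `|` cell s) b'.
    rewrite /b' /c !invgM !invgK.
    apply: parabolic_Bmul => //; apply: parabolic_mul => //; apply: parabolic_Bmul => //.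
    by right; exact: cell_coset.
  case=> // /(cellP Ws sn)[b4 [b5 [Bb4 Bb5 b'E']]]; exfalso.
  apply: (S_mul_neq Ss We); apply: (@bruhat _ _ (b' * k)) => //; first exact: coset_mul.
    rewrite b'E' -!mulgA; apply: cell_Bl => //; apply: u; apply: setmulM => //.
    by apply: cell_Bl => //; exact: cell_coset.
  rewrite b'E mulgVK; apply: cell_Br; [exact: BV|exact: cell_coset].
exists b', c; split=> //; last by rewrite /c !mulgA mulVg mul1g mulgVK; exact: BV.
have -> : c = b'^-1 * b by rewrite bE mulKg.
by apply: BM => //; exact: BV.
Qed.

(** * Longest elements of the subgroups W_J *)

(** Maximality is only local, under left multiplication by J; [longest_len] deduces that all of W_J
    lies on geodesics from 1 to w. *)
Definition longest J w := words J w /\ forall s, J s -> ~ up s w.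

Lemma longest_ex J : J `<=` S -> finite_set (words J) -> exists w, longest J w.
Proof.
move=> JS /finite_fsetP[X XE].
have Pex : exists m, `[< exists2 w, words J w & len w = m >].
  by exists (len T); apply/asboolP; exists T => //; exact: words_T.
have ub m : `[< exists2 w, words J w & len w = m >] -> (m <= \max_(w <- X) len w)%N.
  move=> /asboolP[w Jw <-]; apply: (@leq_bigmax_seq _ _ xpredT len) => //.
  by move: Jw; rewrite XE.
case: (ex_maxnP Pex ub) => m /asboolP[w Jw <-] max_w; exists w; split=> // s Js u.
have Ww := words_coset JS Jw; have Ss := JS _ Js.
have : `[< exists2 v, words J v & len v = len (s ** w) >].
  apply/asboolP; exists (s ** w) => //.
  by apply: words_mul => //; exact: words_gen.
by move=> /max_w; rewrite (up_len Ss Ww u) ltnn.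
Qed.

Lemma cat_eq_cat_cons (X : Type) (l1 l2 l3 l4 : seq X) (t : X) :
  l1 ++ l2 = l3 ++ t :: l4 ->
  (exists l5 : seq X, l1 = l3 ++ t :: l5 /\ l4 = l5 ++ l2) \/
  (exists l5 : seq X, l3 = l1 ++ l5 /\ l2 = l5 ++ t :: l4).
Proof.
elim: l1 l3 => [|a l1 IH] [|b l3] /=; first by move=> ->; right; exists [::].
- by move=> ->; right; exists (b :: l3).
- by case=> -> <-; left; exists l1.
- by case=> -> /IH[[l5 [-> ->]]|[l5 [-> ->]]]; [left|right]; exists l5.
Qed.

(** Induction on the size. Let a J-word of x, followed by a word of x^-1 w, be a reduced word of w.
    Multiplying by s deletes a letter. If it is in the first part, sx has a shorter J-word and
    induction applies, thanks to the bound on the size; if it is in the second, s followed by the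
    first part will do. *)
Lemma longest_len J w l : J `<=` S -> longest J w -> [set` l] `<=` J ->
  exists l', [/\ [set` l'] `<=` J, foldr (@setmul G) T l' = foldr (@setmul G) T l,
    (size l' <= size l)%N &
    (size l' + len (setinv (foldr (@setmul G) T l) ** w) <= len w)%N].
Proof.
move=> JS [Jw nw]; have Ww := words_coset JS Jw.
have [m] := ubnP (size l); elim: m l => // m IH [|s l] /= ltm.
  move=> _; exists [::]; split=> //.
  by rewrite (subgroup_setinv T_subgroup) coset_Tmul.
move=> /sub_cons[Js lJ]; have Ss := JS _ Js; have Ws := S_coset Ss.
have [l1 [l1J <- le1 lelen]] := IH l ltm lJ.
have l1S := subset_trans l1J JS; have Wl1 := foldr_coset l1S.
have [l2 [l2S l2l] yE] := lenP (coset_mul (coset_inv Wl1) Ww).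
have wE : w = foldr (@setmul G) T (l1 ++ l2) by rewrite foldr_cat // -yE coset_mulKV.
have l12S : [set` l1 ++ l2] `<=` S by apply/sub_cat.
have := nw s Js; rewrite {1}wE => /(exchange Ss l12S)[l3 [t [l4 [lE]]]].
rewrite -wE => sw; have [[l5 [E1 E2]]|[l5 [E1 E2]]] := cat_eq_cat_cons lE.
  have [l3J /sub_cons[_ l5J]] : [set` l3] `<=` J /\ [set` t :: l5] `<=` J.
    by apply/sub_cat; rewrite -E1.
  have l35J : [set` l3 ++ l5] `<=` J by apply/sub_cat.
  have l35S := subset_trans l35J JS.
  have sl1 : s ** foldr (@setmul G) T l1 = foldr (@setmul G) T (l3 ++ l5).
    apply: (@coset_mulIr _ _ (foldr (@setmul G) T l2)); [exact: coset_mul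
      |exact: foldr_coset|exact: foldr_coset|].
    by rewrite -setmulA -foldr_cat // -wE sw E2 catA foldr_cat.
  have sz : (size (l3 ++ l5) < size l1)%N.
    by rewrite E1 !size_cat /= addnS ltnS.
  have [|l' [l'J l'E l'le l'len]] := IH (l3 ++ l5) _ l35J.
    exact: leq_trans sz (leq_trans le1 (ltnW ltm)).
  exists l'; rewrite sl1; split=> //.
  exact: leq_trans l'le (leq_trans (ltnW sz) (leqW le1)).
have [l5S /sub_cons[_ l4S]] : [set` l5] `<=` S /\ [set` t :: l4] `<=` S.
  by apply/sub_cat; rewrite -E2.
have l54S : [set` l5 ++ l4] `<=` S by apply/sub_cat.
exists (s :: l1); split=> //; first exact/sub_cons.
have -> : setinv (s ** foldr (@setmul G) T l1) ** w = foldr (@setmul G) T (l5 ++ l4).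
  rewrite setinvM (S_inv Ss) -setmulA sw E1 -catA (foldr_cat l1S l54S).
  by rewrite coset_mulK //; exact: foldr_coset.
apply: leq_trans lelen; rewrite -l2l E2 /= addSn -addnS leq_add2l size_cat /= addnS ltnS.
by rewrite -size_cat; exact: len_le.
Qed.

(** * Minimal coset representatives and parabolic subgroups *)

(** If a new letter s does not lengthen the product, [exchange] deletes a letter. Deleting it in the
    J-word gives a shorter J-word of the same element of W_J; deleting it in the reduced word of y
    would produce an element of W_J y shorter than y. *)
Lemma cell_mul_min J y w : J `<=` S -> W y ->
  (forall x, words J x -> (len y <= len (x ** y))%N) -> words J w ->
  cell w ** cell y `<=` cell (w ** y).
Proof.
move=> JS Wy ymin [l + ->].
have [m] := ubnP (size l); elim: m l => // m IH [|s l] /= ltm.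
  by move=> _; rewrite cell_T mulB_cell coset_Tmul.
move=> /sub_cons[Js lJ]; have Ss := JS _ Js; have Ws := S_coset Ss.
have lS := subset_trans lJ JS; have Wl := foldr_coset lS.
have Wly := coset_mul Wl Wy; rewrite -(setmulA s _ y).
case: (pselect (up s (foldr (@setmul G) T l ** y))) => [u|nu].
  apply: subset_trans (mulB_up u).
  apply: subset_trans (setmulSl (IH l ltm lJ)).
  by rewrite setmulA; apply: setmulSr; exact: cell_mul_sub.
have [ly [lyS lyl] yE] := lenP Wy.
have llyS : [set` l ++ ly] `<=` S by apply/sub_cat.
move: nu; rewrite {1}yE -foldr_cat // => /(exchange Ss llyS)[l3 [t [l4 [lE sw]]]].
have [[l5 [E1 E2]]|[l5 [E1 E2]]] := cat_eq_cat_cons lE.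
  have [l3J /sub_cons[_ l5J]] : [set` l3] `<=` J /\ [set` t :: l5] `<=` J.
    by apply/sub_cat; rewrite -E1.
  have l35J : [set` l3 ++ l5] `<=` J by apply/sub_cat.
  have l35S := subset_trans l35J JS.
  rewrite (setmulA s).
  have -> : s ** foldr (@setmul G) T l = foldr (@setmul G) T (l3 ++ l5).
    apply: (@coset_mulIr _ _ y) => //; [exact: coset_mul|exact: foldr_coset|].
    by rewrite {1}yE -setmulA -foldr_cat // sw E2 catA foldr_cat // -yE.
  by apply: IH => //; rewrite -ltnS (leq_trans _ ltm) // ltnS E1 !size_cat /= !addnS ltnS.
exfalso; have [l5S /sub_cons[_ l4S]] : [set` l5] `<=` S /\ [set` t :: l4] `<=` S.
  by apply/sub_cat; rewrite -E2.
have l54S : [set` l5 ++ l4] `<=` S by apply/sub_cat.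
have Jl : words J (foldr (@setmul G) T l) by exists l.
have /ymin : words J (setinv (foldr (@setmul G) T l) ** (s ** foldr (@setmul G) T l)).
  by do !apply: words_mul => //; [exact: words_inv|exact: words_gen].
have -> : setinv (foldr (@setmul G) T l) ** (s ** foldr (@setmul G) T l) ** y =
    foldr (@setmul G) T (l5 ++ l4).
  rewrite yE -!setmulA -(foldr_cat lS lyS) sw E1 -catA (foldr_cat lS l54S).
  by rewrite coset_mulK //; exact: foldr_coset.
move=> /leq_trans/(_ (len_le l54S)).
by rewrite -lyl E2 !size_cat /= addnS ltnn.
Qed.

(** [S_cell] absorbs the letters of v one at a time. This is the closure under products of P_J, the
    union of the BwB with w in W_J. *)
Lemma words_cell_mul J v w g h : J `<=` S -> words J v -> words J w ->
  cell v g -> cell w h -> exists2 z, words J z & cell z (g * h).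
Proof.
move=> JS [l + ->] Jw + wh; elim: l g => [|s l IH] g /=.
  by rewrite cell_T => _ Bg; exists w => //; exact: cell_Bl.
move=> /sub_cons[Js lJ] /cell_mul_sub [_ [b Bb [n sn <-]] [g' lg' <-]].
have [z Jz zg'] := IH g' lJ lg'; have Ss := JS _ Js.
have := S_cell Ss (words_coset JS Jz) (setmulM sn zg').
rewrite -!mulgA; case=> hz.
  exists (s ** z); first by apply: words_mul => //; exact: words_gen.
  exact: cell_Bl.
by exists z => //; exact: cell_Bl.
Qed.

Lemma bruhat_ex g : exists2 w, W w & cell w g.
Proof.
pose H : set G := [set g | exists2 w, W w & cell w g].
suff : gen (B `|` N) `<=` H by rewrite (BN_gen BN); apply.
apply: gen_subP => [|h [Bh|Nh]].
- split; first by apply: mem_set; exists T; [exact: coset_T|rewrite cell_T].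
  move=> h k; rewrite !inE => -[v /coset_words Sv vh] [w /coset_inv/coset_words Sw].
  move=> /cell_invP/(words_cell_mul (@subset_refl _ S) Sv Sw vh)[z /coset_words].
  by exists z.
- by exists T; [exact: coset_T|rewrite cell_T].
- by have [w Ww wh] := coset_of_N Nh; exists w => //; exact: cell_coset.
Qed.

(** * Chambers of W_J when a longest element exists *)

Section Longest.
Variables (J : set (set G)) (w0 : set G).
Hypotheses (JS : J `<=` S) (w0P : longest J w0).

Let Ww0 : W w0 := words_coset JS (proj1 w0P).

Lemma longest_len_le v : words J v -> (len v + len (setinv v ** w0) <= len w0)%N.
Proof.
move=> [l lJ ->]; have [l' [l'J <- _ le]] := longest_len JS w0P lJ.
by apply: leq_trans le; rewrite leq_add2r len_le //; exact: subset_trans JS.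
Qed.

Lemma fixes_longest v b : words J v -> B b -> fixes b w0 -> fixes b v.
Proof.
move=> Jv Bb fb; have Wv := words_coset JS Jv.
apply: (fixes_gate Wv (coset_mul (coset_inv Wv) Ww0)) => //.
  by rewrite coset_mulKV //; exact: longest_len_le.
by rewrite coset_mulKV.
Qed.

Section Panel.
Variable s : set G.
Hypothesis Js : J s.

Let Ss : S s := JS Js.
Let Ws : W s := S_coset Ss.
Let e := s ** w0.
Let We : W e := coset_mul Ws Ww0.

Lemma up_panel : up s e.
Proof. by case: (up_or Ss Ww0) => // /(proj2 w0P s Js). Qed.

Lemma len_panel : len w0 = (len e).+1.
Proof. exact: not_up_len (proj2 w0P s Js). Qed.

(** sv lies on a geodesic from 1 to w0, and both sv and w0 = se are longer by one than v and e. So v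
    lies on a geodesic from 1 to e. *)
Lemma fixes_panel v b : words J v -> up s v -> B b -> fixes b e -> fixes b v.
Proof.
move=> Jv u Bb fb; have Wv := words_coset JS Jv.
apply: (fixes_gate Wv (coset_mul (coset_inv Wv) We)) => //; last by rewrite coset_mulKV.
rewrite coset_mulKV // -ltnS -len_panel -addSn -(up_len Ss Wv u).
have Jsv : words J (s ** v) by apply: words_mul => //; exact: words_gen.
by have := longest_len_le Jsv; rewrite setinvM (S_inv Ss) -setmulA.
Qed.

(** e lies on a geodesic from 1 to w0 and is shorter by one, so e^-1 w0 has length at most one; it
    is not trivial since sw0 differs from w0. *)
Lemma opposite_panel : exists2 t, S t & e ** t = w0.
Proof.
have Je : words J e by apply: words_mul; [|exact: words_gen|exact: (proj1 w0P)].
have := longest_len_le Je; rewrite len_panel -addn1 leq_add2l.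
have Wt := coset_mul (coset_inv We) Ww0.
have w0E : w0 = e ** (setinv e ** w0) by rewrite coset_mulKV.
have [l [lS <-] tE] := lenP Wt; case: l lS tE => [|t [|r l]] //=.
  by move=> _ tE; move: w0E; rewrite tE coset_mulT // => /esym/(S_mul_neq Ss Ww0).
move=> /sub_cons[St _] tE _; exists t => //.
by rewrite [RHS]w0E tE /= coset_mulT //; exact: S_coset.
Qed.

(* With b and b1 fixing the half of the apartment containing e, so does x: it fixes B and
   stabilises the panel of e in direction t, whose projection on B is e. *)
Lemma panel_closed n b b1 (x : G) : s n -> B b -> fixes b e -> B b1 -> fixes b1 e -> B x ->
  n * b * n^-1 = b1 * n * x -> fixes x e.
Proof.
move=> sn Bb fb Bb1 fb1 Bx E; have [t St et] := opposite_panel.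
have [k ek] := coset_ex We.
have Wt := S_coset St.
(* Conjugation by e carries s to t, because e^-1 s e = e^-1 w0. *)
have tq : t (k^-1 * (n^-1 * k)).
  have <- : setinv e ** w0 = t by rewrite -et coset_mulK.
  apply: setmulM; first by apply/setinvP; rewrite invgK.
  have -> : w0 = s ** e by rewrite S_mulK.
  by apply: setmulM => //; exact: S_invg.
set q := k^-1 * (n^-1 * k) in tq.
have nE : n = k * q^-1 * k^-1 by rewrite /q !invgM !invgK !mulgA mulgV mul1g mulgK.
have niE : n^-1 = k * q * k^-1 by rewrite /q !mulgA mulgV mul1g mulgK.
clearbody q.
have xE : k^-1 * x * k = q * ((k^-1 * b1^-1 * k) * (q^-1 * ((k^-1 * b * k) * q))).
  have -> : x = n^-1 * b1^-1 * (n * b * n^-1) by rewrite E !mulgA mulgVK mulVg mul1g.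
  by rewrite niE nE !mulgA mulVg mul1g !mulgVK.
apply: (fixes_rep We ek).
apply: (@cell_parabolic e t k) => //; first by rewrite et len_panel.
  rewrite xE; apply: parabolic_mul => //; apply: parabolic_Bmul.
    exact: fixesV fb1 _ ek.
  apply: parabolic_mul => //; first exact: S_invg.
  apply: parabolic_Bmul; first exact: fb.
  by right; exact: cell_coset.
by rewrite -mulgA mulVKg; apply: cell_Bl => //; exact: cell_coset.
Qed.

(** Splitting b^-1 by [fixes_transitive] leaves a factor that crosses n and stays in B, giving b0.
    If y = n b' n^-1 lies in BsB, its left factor in B is split likewise: the part fixing eB becomes
    b1, and the part fixing nB crosses n into x. *)
Lemma panel_decomp n b : s n -> B b -> exists b0 b', [/\ B b0, B b', fixes b' e,
  n * b = b0 * n * b' &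
  B (n * b' * n^-1) \/ exists b1 (x : G),
    [/\ B b1, fixes b1 e, B x, fixes x e & n * b' * n^-1 = b1 * n * x]].
Proof.
move=> sn Bb; have sni := S_invg Ss sn.
have [b' [c [bE Bb' fb' Bc]]] := fixes_transitive Ss We up_panel sni (BV Bb).
rewrite invgK => Bnc; exists (n * c^-1 * n^-1), b'^-1; split.
- by have := BV Bnc; rewrite !invgM !invgK mulgA.
- exact: BV.
- exact: fixesV.
- by rewrite -[b]invgK bE invgM !mulgA mulgVK.
have : (B `|` cell s) (n * (b'^-1 * n^-1)).
  apply: parabolic_mul => //; apply: parabolic_Bmul; first exact: BV.
  by right; exact: cell_coset.
rewrite mulgA => -[|sy]; [by left|right].
have [b1 [c1 [Bb1 Bc1 yE]]] := cellP Ws sn sy.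
have [b2 [d [b1E Bb2 fb2 Bd Bnd]]] := fixes_transitive Ss We up_panel sn Bb1.
have yE' : n * b'^-1 * n^-1 = b2 * n * (n^-1 * d * n * c1).
  by rewrite yE b1E !mulgA mulgK.
exists b2, (n^-1 * d * n * c1); split=> //; first exact: BM.
by apply: panel_closed yE' => //; [exact: BV|exact: fixesV|exact: BM].
Qed.

End Panel.

(** b' is chosen so that nb and b'n agree on w0B. Then h = n^-1 b'^-1 n b fixes w0B and B, hence
    every xB by [fixes_longest]. *)
Lemma min_coset_move y n b : W y ->
  (forall x, words J x -> (len y <= len (x ** y))%N) ->
  setinv y n -> B b ->
  exists2 b', B b' & forall x m, words J x -> x m -> B ((b' * n * m)^-1 * (n * b * m)).
Proof.
move=> Wy ymin yn Bb; have [m0 wm0] := coset_ex Ww0; have Jw0 := proj1 w0P.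
have Wy' := coset_inv Wy.
(* The form of [cell_mul_min] for left cosets of W_J, by taking inverses. *)
have cellM x g h : words J x -> cell (setinv y) g -> cell x h -> cell (setinv y ** x) (g * h).
  move=> Jx /cell_invP yg /cell_invP xh; rewrite -[_ * _]invgK.
  have -> : setinv y ** x = setinv (setinv x ** y) by rewrite setinvM !setinvK.
  apply: cell_invP; apply: (cell_mul_min JS Wy ymin (words_inv JS Jx)).
  by rewrite invgM setinvK in yg *; apply: setmulM.
have : cell (setinv y ** w0) (n * (b * m0)).
  by apply: cellM => //; [exact: cell_coset|apply: cell_Bl => //; exact: cell_coset].
move=> /(cellP (coset_mul Wy' Ww0) (setmulM yn wm0))[b' [c [Bb' Bc E]]].
exists b' => //; pose h := n^-1 * b'^-1 * n * b.
have hE : m0^-1 * h * m0 = c.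
  have -> : h = n^-1 * b'^-1 * (n * (b * m0)) * m0^-1 by rewrite /h !mulgA mulgK.
  by rewrite E !mulgA !mulgVK mulVg mul1g.
(* h is a conjugate of c by m0, so it lies in some BzB with z in W_J. Then nh lies in both By^-1B
   and By^-1zB, whence z = 1. *)
have Bh : B h.
  have [z Jz zh] : exists2 z, words J z & cell z (m0 * c * m0^-1).
    apply: (words_cell_mul JS Jw0 (words_inv JS Jw0)).
      by apply: cell_Br => //; exact: cell_coset.
    by apply: cell_invP; exact: cell_coset.
  have h_eq : m0 * c * m0^-1 = h by rewrite -hE !mulgA mulgV mul1g mulgK.
  rewrite {}h_eq in zh; have Wz := words_coset JS Jz.
  have nh : cell (setinv y) (n * h).
    rewrite /h !mulgA mulgV mul1g; apply: cell_Br => //.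
    by apply: cell_Bl; [exact: BV|exact: cell_coset].
  have := bruhat Wy' (coset_mul Wy' Wz) nh (cellM _ _ _ Jz (cell_coset yn) zh).
  move=> /(congr1 (fun v => y ** v)); rewrite (setmulA y _ z) (coset_invr Wy) coset_Tmul //.
  by move=> zT; rewrite -zT cell_T in zh.
have fh : fixes h w0 by apply: (fixes_rep Ww0 wm0); rewrite hE.
move=> x m Jx xm; have := fixes_longest Jx Bh fh xm.
by rewrite /h !invgM !mulgA.
Qed.

End Longest.

(** y is taken shortest in W_J w^-1. *)
Lemma min_coset_ex J w : J `<=` S -> W w ->
  exists x y, [/\ words J x, W y, w = setinv y ** x &
    forall x', words J x' -> (len y <= len (x' ** y))%N].
Proof.
move=> JS Ww; have Wi := coset_inv Ww.
have Pex : exists m, `[< exists2 x, words J x & len (x ** setinv w) = m >].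
  by exists (len (T ** setinv w)); apply/asboolP; exists T => //; exact: words_T.
case: (ex_minnP Pex) => m /asboolP[x Jx <-] xmin.
have Wx := words_coset JS Jx; exists x, (x ** setinv w); split=> //.
- exact: coset_mul.
- by rewrite setinvM setinvK -setmulA coset_invl // coset_mulT.
move=> x' Jx'; apply: xmin; apply/asboolP; exists (x' ** x); first exact: words_mul.
by rewrite setmulA.
Qed.

End BNPair.

(** * Induced modules *)

Section GroupAlgebraModule.
Local Open Scope ring_scope.
Variables (k : fieldType) (G : groupType).
Implicit Types (g h : G) (c : k) (a : group_algebra k G).

Local Notation A := (group_algebra k G).

Lemma ga_of1 : ga_of k (1 : G)%g = 1.
Proof. by []. Qed.

Lemma ga_ofM g h : ga_of k g * ga_of k h = ga_of k (g * h)%g.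
Proof. by rewrite /ga_of [LHS]ga_mulUU mulr1. Qed.

Lemma ga_scalar1 : ga_scalar G (1 : k) = 1.
Proof. by []. Qed.

Lemma ga_scalarN1 : ga_scalar G (-1 : k) = -1.
Proof. exact: monalgUN. Qed.

Lemma ga_of_scalar g c : ga_of k g * ga_scalar G c = ga_scalar G c * ga_of k g.
Proof. by rewrite [LHS]ga_mulUU [RHS]ga_mulUU mul1r mulr1 mul1g mulg1. Qed.

Lemma gaE a : a = \sum_(g <- msupp a) ga_scalar G a@_g * ga_of k g :> A.
Proof.
rewrite [LHS]monalgE; apply: eq_bigr => g _.
by rewrite [RHS]ga_mulUU mulr1 mul1g.
Qed.

Lemma ga_sub_of (H : set G) g : H g -> @ga_sub k G H (ga_of k g).
Proof.
move=> Hg h /=; rewrite /ga_of => /(fsubsetP (@msuppU_le _ _ _ _)).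
by rewrite inE => /eqP->.
Qed.

End GroupAlgebraModule.

(** * Subspaces and spans in the induced module *)

Section Induced.
Local Open Scope ring_scope.
Variables (k : fieldType) (G : groupType) (B : set G).
Implicit Types (g h : G) (c : k) (V : set (induced_triv k B)).

Local Notation A := (group_algebra k G).
Local Notation M := (induced_triv k B).

Lemma ga_of_scale g h (x : M) : ga_of k g *: (ga_of k h *: x) = ga_of k (g * h)%g *: x.
Proof. by rewrite scalerA ga_ofM. Qed.

Lemma scale_tens (a b : A) c : a *: (tens _ _ b c : M) = tens _ _ (a * b) c.
Proof.
have := tensor_scale_pi (@ga_sub k G B) (@triv_act k G) a << (b, c) >>.
by rewrite lmulU.
Qed.

(** The tensor product is balanced over kB and b acts trivially on k_tr, so only the chamber gB
    matters. *)
Lemma tens_mulB g b c : B b ->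
  tens _ _ (ga_of k (g * b)%g) c = tens _ _ (ga_of k g) c :> M.
Proof.
move=> Bb; rewrite -ga_ofM; apply/eqP; rewrite tensor_pi_eq.
have cE : triv_act (ga_of k b) c = c.
  rewrite /triv_act (big_fset_incl _ (@msuppU_le _ _ _ _)) /=.
    by rewrite big_seq_fset1 mcoeffUU mul1r.
  by move=> x _ /mcoeff_outdom.
rewrite -{2}cE; apply: tensor_rel_ker; apply: TensorBal.
exact: ga_sub_of.
Qed.

Lemma k_subspaceD V x y : k_subspace V -> V x -> V y -> V (x + y).
Proof. by case=> _ VD Vx Vy; rewrite -[x]scale1r -(ga_scalar1 k G); apply: VD. Qed.

Lemma k_subspaceZ V c x : k_subspace V -> V x -> V (ga_scalar G c *: x).
Proof. by case=> V0 VD Vx; rewrite -[_ *: _]addr0; apply: VD. Qed.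

Lemma k_subspaceN V x : k_subspace V -> V x -> V (- x).
Proof. by move=> Vs Vx; rewrite -scaleN1r -ga_scalarN1; apply: k_subspaceZ. Qed.

Lemma k_subspaceB V x y : k_subspace V -> V x -> V y -> V (x - y).
Proof. by move=> Vs Vx Vy; apply: k_subspaceD => //; apply: k_subspaceN. Qed.

Lemma k_subspace_preim V g : k_subspace V -> k_subspace [set x | V (ga_of k g *: x)].
Proof.
move=> [V0 VD]; split=> [|c x y Vx Vy] /=; first by rewrite scaler0.
have -> : ga_of k g *: (ga_scalar G c *: x + y) =
    ga_scalar G c *: (ga_of k g *: x) + ga_of k g *: y.
  by rewrite scalerDr !scalerA ga_of_scalar.
exact: (VD c _ _ Vx Vy).
Qed.

Lemma kspan_subspace (X : set M) : k_subspace (kspan X).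
Proof.
split=> [V [[]]//|c x y Xx Xy V VP]; have [[_ VD] _] := VP.
by apply: VD; [exact: Xx|exact: Xy].
Qed.

Lemma kspan_sub (X V : set M) : k_subspace V -> X `<=` V -> kspan X `<=` V.
Proof. by move=> Vs XV; apply: smallest_sub. Qed.

Lemma mem_kspan (X : set M) : X `<=` kspan X.
Proof. exact: sub_gen_smallest. Qed.

Lemma k_subspace_act V (a : A) x : k_subspace V ->
  (forall g, g \in msupp a -> V (ga_of k g *: x)) -> V (a *: x).
Proof.
move=> Vs Vg; rewrite [a]gaE scaler_suml big_seq.
apply: (big_ind V); first by case: Vs.
  by move=> y z; exact: k_subspaceD.
by move=> g ag; rewrite -scalerA; apply: k_subspaceZ => //; exact: Vg.
Qed.

Lemma k_subspace_submod V : k_subspace V ->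
  (forall g x, V x -> V (ga_of k g *: x)) -> GRing.submod_closed [in V].
Proof.
move=> Vs Vg; split; first by apply: mem_set; case: Vs.
move=> a x y; rewrite !inE => Vx Vy; apply: k_subspaceD => //.
by apply: k_subspace_act => // g _; exact: Vg.
Qed.

Lemma kspan_ga_sub (H : set G) (x : M) :
  [set a *: x | a in @ga_sub k G H] = kspan [set ga_of k h *: x | h in H].
Proof.
apply/seteqP; split=> [_ [a aH <-]|].
  apply: k_subspace_act; first exact: kspan_subspace.
  by move=> g ag; apply: mem_kspan; exists g => //; exact: aH.
apply: kspan_sub => [|_ [h Hh <-]]; last by exists (ga_of k h) => //; exact: ga_sub_of.
split; first by exists 0; rewrite ?scale0r // => g /=; rewrite msupp0 inE.
move=> c _ _ [a aH <-] [b bH <-].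
exists (ga_scalar G c * a + b); last by rewrite scalerDl scalerA.
move=> g /= /(fsubsetP (msuppD_le _ _)); rewrite inE => /orP[|/bH //].
have -> : ga_scalar G c * a = \sum_(h <- msupp a) << c * a@_h *g h >>.
  rewrite {1}[a]monalgE [LHS](ga_mul_sumr (msupp a)); apply: eq_bigr => h _.
  by rewrite ga_mulUU mul1g.
(* The support of a scalar multiple of a is contained in that of a. *)
move=> gs; apply: aH; apply: contraLR gs => ga.
rewrite -mcoeff_eq0 (raddf_sum (mcoeff g)) /= big_seq big1 // => h ah.
rewrite mcoeffU; case: eqP => [hg|//]; first by rewrite -hg ah in ga.
Qed.

End Induced.

(** * Chambers and the alternating sums eta_J *)

Section Steinberg.
Local Open Scope ring_scope.
Variables (G : groupType) (B N : set G) (S : set (set G)).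
Hypothesis BN : BN_pair B N S.
Variables (k : fieldType) (one_tr : k) (rep : set G -> G).
Hypothesis repP : forall w, coset_group N (B `&` N) w -> w (rep w).

Local Notation M := (induced_triv k B).
Local Notation T := (B `&` N).
Local Notation W := (coset_group N T).
Local Notation "A ** C" := (setmul A C) (at level 40, left associativity).
Local Notation len := (coxeter_length T S).
Local Notation words := (words B N).

Implicit Types (g h n b : G) (v w s : set G) (J : set (set G)).

Definition chamber g : M := tens _ _ (ga_of k g) one_tr.

Lemma act_chamber g h : ga_of k g *: chamber h = chamber (g * h)%g.
Proof. by rewrite /chamber scale_tens ga_ofM. Qed.

Lemma chamber_eq g h : B (g^-1 * h)%g -> chamber h = chamber g.
Proof. by move=> Bgh; rewrite /chamber -(tens_mulB g one_tr Bgh) mulVKg. Qed.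

Lemma chamber_rep w n : W w -> w n -> chamber n = chamber (rep w).
Proof.
move=> Ww wn; apply: chamber_eq.
by have [_ /(_ n)/iffLR/(_ wn)[]] := cosetP BN Ww (repP Ww).
Qed.

Lemma chamber_fixes b w n : W w -> w n -> fixes B b w -> chamber (b * n)%g = chamber n.
Proof. by move=> Ww wn fb; apply: chamber_eq; rewrite mulgA; exact: fb. Qed.

Lemma chamber_coset n w v : W w -> W v -> w n -> chamber (n * rep v)%g = chamber (rep (w ** v)).
Proof.
by move=> Ww Wv wn; apply: chamber_rep; [exact: (coset_mul BN)|apply: setmulM => //; exact: repP].
Qed.

Local Notation sgn w := ((-1) ^+ len w : group_algebra k G).

Local Notation eta J := (eta_sum B N S rep one_tr J).

Lemma sgnK w (x : M) : sgn w *: (sgn w *: x) = x.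
Proof. by rewrite scalerA -expr2 sqrr_sign scale1r. Qed.

(** If the chamber of 1 is zero, so is every term. Otherwise no term is zero, since group elements
    and signs are invertible, and the sum has infinite support. *)
Lemma eta_dflt J : J `<=` S -> infinite_set (words J) -> eta J = 0.
Proof.
move=> JS Jinf; rewrite /eta_sum /alt_sum (coset_genE BN JS).
have [c0|c0] := eqVneq (chamber 1%g) 0.
  apply: fsbig1 => w _; rewrite -/(chamber (rep w)).
  by rewrite -[rep w]mulg1 -act_chamber c0 !scaler0.
apply: fsbig_dflt; set F := (X in _ `&` X); rewrite (_ : _ `&` F = words J) //.
apply/seteqP; split=> [w []//|w Jw]; split=> //; rewrite /F /=.
rewrite -/(chamber (rep w)) => /(congr1 (fun x => ga_of k (rep w)^-1 *: (sgn w *: x))).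
rewrite sgnK act_chamber mulVg => c1; move/eqP: c0; apply.
by rewrite c1 !scaler0.
Qed.

Lemma scaler_fsumr (a : group_algebra k G) (X : set (set G)) (F : set G -> M) :
  finite_set X -> a *: (\sum_(w \in X) F w) = \sum_(w \in X) a *: F w.
Proof.
move=> Xfin; have E (H : set G -> M) := fsbig_finite +%R H Xfin.
apply: etrans (congr1 _ (E F)) _; apply: etrans (esym (E _)).
exact: scaler_sumr.
Qed.

Lemma act_sgn g w (x : M) : ga_of k g *: (sgn w *: x) = sgn w *: (ga_of k g *: x).
Proof. by rewrite !scalerA GRing.commr_sign. Qed.

Lemma act_eta J g : J `<=` S -> finite_set (words J) ->
  ga_of k g *: eta J = \sum_(w \in words J) sgn w *: chamber (g * rep w)%g.
Proof.
move=> JS Jfin; rewrite /eta_sum /alt_sum (coset_genE BN JS).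
rewrite (scaler_fsumr _ _ Jfin); apply: eq_fsbigr => w _.
by rewrite act_sgn -/(chamber (rep w)) act_chamber.
Qed.

Lemma sgn_S s v : S s -> W v -> sgn (s ** v) = - sgn v.
Proof.
move=> Ss Wv; case: (pselect (up B s v)) => [u|nu].
  by rewrite (up_len BN Ss Wv u) exprS mulN1r.
by rewrite (not_up_len BN Ss Wv nu) exprS mulN1r opprK.
Qed.

(** Multiplication by s is a bijection from the elements of W_J that s shortens to those that it
    lengthens. *)
Lemma sum_panel J s (F : set G -> M) : J `<=` S -> J s -> finite_set (words J) ->
  \sum_(w \in words J) F w =
  \sum_(w \in words J `&` [set w | up B s w]) (F w + F (s ** w)).
Proof.
move=> JS Js Jfin; have Ss := JS _ Js.
have JW w : words J w -> W w by exact: (words_coset BN).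
rewrite (fsbigID [set w | up B s w]) //= fsbig_split //; last exact: finite_setIl.
congr (_ + _); apply: reindex_fsbig; split.
- move=> w [Jw u]; split; first by apply: (words_mul BN) => //; exact: (words_gen BN).
  by apply: (up_not_up BN) => //; exact: JW.
- move=> v w; rewrite !inE => -[/JW Wv _] [/JW Ww _] e.
  by rewrite -(S_mulK BN Ss Wv) e (S_mulK BN).
- move=> w [Jw nu]; exists (s ** w); last by rewrite (S_mulK BN) //; exact: JW.
  split; first by apply: (words_mul BN) => //; exact: (words_gen BN).
  by case: (up_or BN Ss (JW _ Jw)).
Qed.

(** * Relations satisfied by eta_J, checked panel by panel *)

Lemma scale_swap (R : nzRingType) (V : lmodType R) (a : R) (p q : V) :
  a *: p = q -> a *: q = p -> (a + 1) *: (p - q) = 0.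
Proof. by move=> ap aq; rewrite scalerDl scale1r scalerBr ap aq addrC subrKA subrr. Qed.

(** In [act_panel_eta], p and q are the chambers of w and sw, a is y, and b is [b1]. *)
Lemma scale_panel (R : nzRingType) (V : lmodType R) (a b : R) (p q : V) :
  a *: q = q -> a *: p = b *: q -> b *: p = p -> (a + b - 1) *: (p - q) = 0.
Proof.
move=> aq ap bp; rewrite scalerBl scalerDl scale1r !scalerBr aq ap bp.
by rewrite [X in X - _]addrC subrKA subrr.
Qed.

Lemma eta_panel J s : J `<=` S -> J s -> finite_set (words J) ->
  eta J = \sum_(w \in words J `&` [set w | up B s w])
            sgn w *: (chamber (rep w) - chamber (rep (s ** w))).
Proof.
move=> JS Js Jfin; rewrite /eta_sum /alt_sum (coset_genE BN JS).
apply: etrans (sum_panel _ JS Js Jfin) _; apply: eq_fsbigr => w /set_mem[Jw _].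
by rewrite (sgn_S (JS _ Js) (words_coset BN JS Jw)) scaleNr scalerBr.
Qed.

Lemma act_eta_eq0 J s (a : group_algebra k G) : J `<=` S -> J s -> finite_set (words J) ->
  (forall w, words J w -> up B s w ->
    a *: (chamber (rep w) - chamber (rep (s ** w))) = 0) ->
  a *: eta J = 0.
Proof.
move=> JS Js Jfin a0; rewrite (eta_panel JS Js Jfin) scaler_fsumr; last exact: finite_setIl.
apply: fsbig1 => w [Jw u].
have -> : a *: (sgn w *: (chamber (rep w) - chamber (rep (s ** w)))) =
    sgn w *: (a *: (chamber (rep w) - chamber (rep (s ** w)))).
  by rewrite !scalerA GRing.commr_sign.
by rewrite (a0 w Jw u) scaler0.
Qed.

Lemma act_S_eta J s n : J `<=` S -> J s -> finite_set (words J) -> s n ->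
  ga_of k n *: eta J = - eta J.
Proof.
move=> JS Js Jfin sn; have Ss := JS _ Js; have Ws := S_coset BN Ss.
apply/eqP; rewrite -addr_eq0 -{2}[eta J]scale1r -scalerDl; apply/eqP.
apply: (act_eta_eq0 JS Js Jfin) => w Jw _; have Ww := words_coset BN JS Jw.
have act v : W v -> ga_of k n *: chamber (rep v) = chamber (rep (s ** v)).
  by move=> Wv; rewrite (act_chamber n) (chamber_coset Ws Wv sn).
apply: scale_swap; first exact: act.
by rewrite (act _ (coset_mul BN Ws Ww)) (S_mulK BN Ss Ww).
Qed.

(** Let s lengthen w. Then y fixes swB, since n^-1 carries it to wB, which b fixes. As c fixes wB, y
    carries wB to b1 swB; and b1 fixes wB. So y + b1 - 1 kills the difference of the two
    chambers. *)
Lemma act_panel_eta J s e n b b1 c : J `<=` S -> J s -> finite_set (words J) -> s n ->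
  (forall g w, words J w -> up B s w -> B g -> fixes B g e -> fixes B g w) ->
  B b -> fixes B b e -> B b1 -> fixes B b1 e -> B c -> fixes B c e ->
  (n * b * n^-1 = b1 * n * c)%g ->
  ga_of k (n * b * n^-1)%g *: eta J = eta J - ga_of k b1 *: eta J.
Proof.
move=> JS Js Jfin sn fe Bb fb Bb1 fb1 Bc fc yE; set y := (n * b * n^-1)%g in yE *.
have Ss := JS _ Js; have Ws := S_coset BN Ss.
apply/eqP; rewrite -subr_eq0 opprB addrA -{3}[eta J]scale1r -scalerDl -scalerBl; apply/eqP.
apply: (act_eta_eq0 JS Js Jfin) => w Jw u; have Ww := words_coset BN JS Jw.
have ni : s n^-1%g by exact: (S_invg BN).
have cf g : B g -> fixes B g e -> chamber (g * rep w)%g = chamber (rep w).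
  by move=> Bg fg; apply: (chamber_fixes Ww (repP Ww)); exact: (fe g w).
have sw v : W v -> ga_of k n *: chamber (rep v) = chamber (rep (s ** v)).
  by move=> Wv; rewrite act_chamber; exact: chamber_coset.
have swi v : W v -> ga_of k n^-1%g *: chamber (rep v) = chamber (rep (s ** v)).
  by move=> Wv; rewrite act_chamber; exact: chamber_coset.
have act1 g : B g -> fixes B g e -> ga_of k g *: chamber (rep w) = chamber (rep w).
  by move=> Bg fg; rewrite act_chamber; exact: cf.
have y_sw : ga_of k y *: chamber (rep (s ** w)) = chamber (rep (s ** w)).
  rewrite /y -2!ga_of_scale (swi _ (coset_mul BN Ws Ww)) (S_mulK BN Ss Ww).
  by rewrite (act1 b Bb fb) sw.
have y_w : ga_of k y *: chamber (rep w) = ga_of k b1 *: chamber (rep (s ** w)).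
  by rewrite yE -2!ga_of_scale (act1 c Bc fc) sw.
exact: scale_panel y_sw y_w (act1 b1 Bb1 fb1).
Qed.

(** * Stability of kB eta_J under P_J *)

Local Notation spanB J := (kspan [set ga_of k b *: eta J | b in B]).

Lemma act_B_spanB J b x : B b -> spanB J x -> spanB J (ga_of k b *: x).
Proof.
move=> Bb; apply: (kspan_sub (k_subspace_preim _ (kspan_subspace _))) => _ [c Bc <-] /=.
apply: mem_kspan; exists (b * c)%g; first exact: subgroupM (BN_B BN) Bb Bc.
by rewrite ga_of_scale.
Qed.

Lemma act_S_spanB J s n x : J `<=` S -> J s -> s n -> spanB J x ->
  spanB J (ga_of k n *: x).
Proof.
move=> JS Js sn; have spanS := kspan_subspace [set ga_of k b *: eta J | b in B].
apply: (kspan_sub (k_subspace_preim _ spanS)) => _ [b Bb <-] /=.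
have etaB c : B c -> spanB J (ga_of k c *: eta J).
  by move=> Bc; apply: mem_kspan; exists c.
case: (pselect (finite_set (words J))) => [Jfin|Jinf]; last first.
  have -> : ga_of k n *: (ga_of k b *: eta J) = 0.
    by rewrite (eta_dflt JS Jinf) 2!scaler0.
  exact: (proj1 spanS).
have [w0 w0P] := longest_ex BN JS Jfin.
have [b0 [b' [Bb0 Bb' fb' nbE yP]]] := panel_decomp BN JS w0P Js sn Bb.
set y := (n * b' * n^-1)%g in yP.
(* n b eta = b0 n b' eta = b0 y n eta, and n eta = - eta. *)
have -> : ga_of k n *: (ga_of k b *: eta J) = - (ga_of k b0 *: (ga_of k y *: eta J)).
  rewrite ga_of_scale nbE -(mulgVK n (b0 * n * b')%g).
  have -> : (b0 * n * b' * n^-1 = b0 * y)%g by rewrite /y !mulgA.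
  by rewrite -2!ga_of_scale (act_S_eta JS Js Jfin sn) 2!scalerN.
apply: (k_subspaceN spanS); apply: act_B_spanB => //.
case: yP => [/etaB//|[b1 [c [Bb1 fb1 Bc fc yE]]]].
rewrite (@act_panel_eta J s (setmul s w0) n b' b1 c) //; last first.
  by move=> g w Jw u Bg; exact: (fixes_panel BN JS w0P Js Jw u Bg).
apply: (k_subspaceB spanS); last exact: etaB.
apply: mem_kspan; exists 1%g; first exact: subgroup1 (BN_B BN).
by rewrite ga_of1 scale1r.
Qed.

Lemma act_words_spanB J w g x : J `<=` S -> words J w -> cell B w g -> spanB J x ->
  spanB J (ga_of k g *: x).
Proof.
move=> JS [l + ->]; elim: l g => [|s l IH] g /=.
  by rewrite (cell_T BN) => _; exact: act_B_spanB.
move=> /sub_cons[Js lJ] /(cell_mul_sub BN) [_ [b Bb [n sn <-]] [g' lg' <-]] Vx.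
rewrite -2!ga_of_scale; apply: (act_B_spanB Bb).
by apply: (act_S_spanB JS Js sn); exact: IH.
Qed.

(** T fixes each chamber wB, because Tw = w. *)
Lemma act_T_eta J t : J `<=` S -> T t -> ga_of k t *: eta J = eta J.
Proof.
move=> JS Tt; case: (pselect (finite_set (words J))) => [Jfin|Jinf]; last first.
  by rewrite (eta_dflt JS Jinf) scaler0.
rewrite (act_eta _ JS Jfin) /eta_sum /alt_sum (coset_genE BN JS).
apply: eq_fsbigr => w /set_mem Jw; have Ww := words_coset BN JS Jw.
by rewrite (chamber_coset (coset_T BN) Ww Tt) (coset_Tmul BN Ww).
Qed.

(** * Passage from B to U, and the two submodules *)

Variable U : set G.
Hypotheses (U_subgroup : subgroup U) (TU : T ** U = B).

Lemma B_UT b : B b -> exists u t, [/\ U u, T t & b = (u * t)%g].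
Proof.
move=> /(subgroupV (BN_B BN)) Bb.
have [t Tt [u Uu E]] : (T ** U) b^-1%g by rewrite TU.
exists u^-1%g, t^-1%g; split; first exact: subgroupV.
  exact: subgroupV (T_subgroup BN) Tt.
by rewrite -invgM E invgK.
Qed.

Local Notation spanUW J :=
  (kspan [set ga_of k (u * rep w)%g *: eta J | u in U & w in W]).

(** Write b = ut. Then tn is the chosen representative of its coset times an element of T, and the
    latter fixes eta. *)
Lemma act_BN_eta J b n : J `<=` S -> B b -> N n -> spanUW J (ga_of k (b * n)%g *: eta J).
Proof.
move=> JS /B_UT[u [t [Uu Tt ->]]] Nn; have [w Ww wn] := coset_of_N BN Nn.
have wtn : w (t * n)%g by rewrite -(coset_Tmul BN Ww); exact: setmulM.
have [_ /(_ (t * n)%g)/iffLR/(_ wtn) Tr] := cosetP BN Ww (repP Ww).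
have -> : (u * t * n = u * rep w * ((rep w)^-1 * (t * n)))%g by rewrite !mulgA mulgK.
rewrite -ga_of_scale (act_T_eta JS Tr).
apply: mem_kspan; exists u; first exact: Uu.
by exists w; first exact: Ww.
Qed.

(** With w = y^-1 v from [min_coset_ex], g = b n g' where g' lies in BvB. First g' keeps eta in kB
    eta; then b n c eta = b c' n eta for c in B, with c' in B from [min_coset_move]. *)
Lemma act_eta_span J g : J `<=` S -> spanUW J (ga_of k g *: eta J).
Proof.
move=> JS; have spanS := kspan_subspace [set ga_of k (u * rep w)%g *: eta J | u in U & w in W].
case: (pselect (finite_set (words J))) => [Jfin|Jinf]; last first.
  have -> : ga_of k g *: eta J = 0 by rewrite (eta_dflt JS Jinf) scaler0.
  exact: (proj1 spanS).
have [w0 w0P] := longest_ex BN JS Jfin.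
have [w Ww wg] := bruhat_ex BN g.
have [v [y [Jv Wy wE ymin]]] := min_coset_ex BN JS Ww.
move: wg; rewrite wE => /(cell_mul_sub BN)[_ [b Bb [n yn <-]] [g' vg' <-]].
have Nn := coset_N BN (coset_inv BN Wy) yn.
have eta1 : spanB J (eta J).
  apply: mem_kspan; exists 1%g; first exact: subgroup1 (BN_B BN).
  by rewrite ga_of1 scale1r.
have sub : spanB J `<=` [set x | spanUW J (ga_of k (b * n)%g *: x)].
  apply: (kspan_sub (k_subspace_preim _ spanS)) => _ [c Bc <-] /=.
  have [c' Bc' H] := min_coset_move BN JS w0P Wy ymin yn Bc.
  have nc : ga_of k (n * c)%g *: eta J = ga_of k (c' * n)%g *: eta J.
    rewrite (act_eta (n * c)%g JS Jfin) (act_eta (c' * n)%g JS Jfin).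
    apply: eq_fsbigr => x /set_mem Jx; have Wx := words_coset BN JS Jx.
    by rewrite (chamber_eq (H x _ Jx (repP Wx))).
  rewrite ga_of_scale -mulgA -ga_of_scale nc ga_of_scale mulgA.
  exact: (act_BN_eta JS (subgroupM (BN_B BN) Bb Bc') Nn).
have := sub _ (act_words_spanB JS Jv vg' eta1).
by rewrite /= ga_of_scale.
Qed.

Lemma spanUW_submod J : J `<=` S -> GRing.submod_closed [in spanUW J].
Proof.
move=> JS; have spanS := kspan_subspace [set ga_of k (u * rep w)%g *: eta J | u in U & w in W].
apply: (k_subspace_submod spanS) => g x.
apply: (kspan_sub (k_subspace_preim _ spanS)) => _ [u Uu [w Ww <-]] /=.
by rewrite ga_of_scale; exact: act_eta_span.
Qed.

(** B = UT and T fixes eta_J. *)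
Lemma spanB_U J : J `<=` S -> [set a *: eta J | a in @ga_sub k G U] = spanB J.
Proof.
move=> JS; rewrite kspan_ga_sub; congr kspan; apply/seteqP; split=> _ [h Hh <-].
  have TUh : (T ** U) (1 * h)%g by apply: setmulM => //; exact: subgroup1 (T_subgroup BN).
  by exists h => //; rewrite TU mul1g in TUh.
have [u [t [Uu Tt ->]]] := B_UT Hh; exists u; first exact: Uu.
by rewrite -ga_of_scale (act_T_eta JS Tt).
Qed.

(** For J = S the group P_J is all of G, by [bruhat_ex]. *)
Lemma spanU_submod : GRing.submod_closed [in [set a *: eta S | a in @ga_sub k G U]].
Proof.
have SS := @subset_refl _ S; rewrite (spanB_U SS).
have spanS := kspan_subspace [set ga_of k b *: eta S | b in B].
apply: (k_subspace_submod spanS) => g x.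
have [w /(coset_words BN) Sw wg] := bruhat_ex BN g.
exact: (act_words_spanB SS Sw wg).
Qed.

End Steinberg.

Local Open Scope ring_scope.

Theorem proposition2p3 (K : closedFieldType) (G : linear_algebraic_group K)
    (B N U : set G) (S : set (set G)) (BN : split_BN_pair B N U S)
    (k : fieldType) (one_tr : k) (one_tr_neq0 : one_tr != 0)
    (rep : set G -> G)
    (repP : forall w, coset_group N (B `&` N) w -> w (rep w))
    (J : set (set G)) (JS : J `<=` S) :
  [/\ GRing.submod_closed
        [in kspan [set ga_of k (u * rep w)%g *: eta_sum B N S rep one_tr J
                  | u in U & w in coset_group N (B `&` N)]],
      eta_sum B N S rep one_tr S =
        alt_sum B N S rep one_tr (coset_group N (B `&` N)) &
      GRing.submod_closed
        [in [set a *: eta_sum B N S rep one_tr S | a in @ga_sub k G U]]].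
Proof.
have BN' : BN_pair B N S by case: BN; split.
have [UG TU] := (bn_U_subgroup BN, bn_TU BN).
split.
- exact: (spanUW_submod BN' one_tr repP UG TU JS).
(* S generates N/T, so both sums run over the same set. *)
- by rewrite /eta_sum (BN_S_gen BN').
- exact: (spanU_submod BN' one_tr repP UG TU).
Qed.
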